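(* Let $K$ be a field, $H$ a finite distributive lattice, $P$ the set of join-irreducible elements of $H$, and $Q$ a subset of $P$. The generalized doset Hibi ring $\mathcal D_K(H,Q)$ is a free $K$-module with basis $$\{T^\nu\mid\nu\in\overline{\mathcal T}(P),\ \nu(y)\equiv0\pmod 2\text{ for any }y\in Q\}.$$ In particular, $\mathcal D_K(H,Q)$ is a normal affine semigroup ring and hence is Cohen-Macaulay.
   Context: An element $\alpha$ of a finite distributive lattice is join-irreducible if $\alpha=\beta\vee\gamma$ implies $\alpha=\beta$ or $\alpha=\gamma$; the unique minimal element of the lattice is counted as join-irreducible. $\overline{\mathcal T}(P)$ is the set of order-reversing maps $\nu\colon P\to\mathbb N=\{0,1,2,\ldots\}$ (i.e. $x\le y$ implies $\nu(x)\ge\nu(y)$). $\{T_x\}_{x\in P}$ is a family of indeterminates and $T^\nu=\prod_{x\in P}T_x^{\nu(x)}$. The generalized doset Hibi ring defined by $H$ and $Q$ is the $K$-subalgebra $\mathcal D_K(H,Q)=K[T^\nu\mid\nu\in\overline{\mathcal T}(P),\ \nu(y)\equiv0\pmod2\text{ for any }y\in Q]$ of the polynomial ring $K[T_x\mid x\in P]$. An affine semigroup ring is a ring $K[S]=K[X^s\mid s\in S]$ with $S$ a finitely generated additive submonoid of some $\mathbb N^r$. *)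

(* Defs.v *)
From HB Require Import structures.
From mathcomp Require Import all_boot all_order all_algebra.
From mathcomp Require Import boolp classical_sets.
From mathcomp Require Import mpoly.

Set Implicit Arguments.
Unset Strict Implicit.
Unset Printing Implicit Defensive.

Import Order.TTheory GRing.Theory.
Local Open Scope ring_scope.

Section Bases.
Variables (K : fieldType) (V : lmodType K).

Definition lin_indep (B : set V) : Prop :=
  forall (s : seq V) (c : V -> K), uniq s -> (forall v, v \in s -> B v) ->
    \sum_(v <- s) c v *: v = 0 -> forall v, v \in s -> c v = 0.

Definition spanning (B : set V) : Prop :=
  forall w : V, exists (s : seq V) (c : V -> K),
    (forall v, v \in s -> B v) /\ w = \sum_(v <- s) c v *: v.

Definition is_basis (B : set V) : Prop := lin_indep B /\ spanning B.

End Bases.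

Section GeneratedSubalgebra.
Variables (K : fieldType) (n : nat) (G : set {mpoly K[n]}).

(* The K-subalgebra K[g | g in G]: intersection of all subalgebras of
   K[X_1, .., X_n] containing G. *)
Definition subalg_pred : {pred {mpoly K[n]}} :=
  fun f => `[< forall S : {pred {mpoly K[n]}}, GRing.subalg_closed S ->
                 (forall g, G g -> g \in S) -> f \in S >].

Lemma subalg_predP f :
  reflect (forall S : {pred {mpoly K[n]}}, GRing.subalg_closed S ->
             (forall g, G g -> g \in S) -> f \in S)
          (f \in subalg_pred).
Proof. exact: asboolP. Qed.

Lemma mem_subalg_pred g : G g -> g \in subalg_pred.
Proof. by move=> Gg; apply/subalg_predP => S _; apply. Qed.

Lemma subalg_pred_closed : GRing.subalg_closed subalg_pred.
Proof.
split.
- by apply/subalg_predP => S [].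
- move=> a u v /subalg_predP Hu /subalg_predP Hv; apply/subalg_predP => S cS GS.
  by case: (cS) => _ Hlin _; apply: Hlin; [apply: Hu | apply: Hv].
- move=> u v /subalg_predP Hu /subalg_predP Hv; apply/subalg_predP => S cS GS.
  by case: (cS) => _ _ Hmul; apply: Hmul; [apply: Hu | apply: Hv].
Qed.

(* In {mpoly K[n]} the inverse of a unit is a constant, and x^-1 = x for a
   nonunit x, so a subalgebra is also closed under the total inverse. *)
Lemma subalg_pred_divalg : GRing.divalg_closed subalg_pred.
Proof.
have [c1 clin cmul] := subalg_pred_closed.
have c0 : 0 \in subalg_pred.
  by have := clin (-1) _ _ c1 c1; rewrite scaleN1r addNr.
split=> // x y Hx Hy; apply: cmul => //.
rewrite /GRing.inv /= /mpoly_inv; case: ifP => // _.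
by rewrite -[_%:MP]mulr1 mul_mpolyC -[_ *: _]addr0; apply: clin.
Qed.

HB.instance Definition _ :=
  GRing.isDivalgClosed.Build K {mpoly K[n]} subalg_pred subalg_pred_divalg.

Record subalg_gen := SubalgGen {
  subalg_val :> {mpoly K[n]};
  subalg_valP : subalg_val \in subalg_pred
}.

HB.instance Definition _ := [isSub for subalg_val].
HB.instance Definition _ := [Choice of subalg_gen by <:].
HB.instance Definition _ :=
  [SubChoice_isSubIntegralDomain of subalg_gen by <:].
HB.instance Definition _ := [SubZmodule_isSubLmodule of subalg_gen by <:].
HB.instance Definition _ :=
  [SubNzRing_SubLmodule_isSubLalgebra of subalg_gen by <:].
HB.instance Definition _ := [SubLalgebra_isSubAlgebra of subalg_gen by <:].

End GeneratedSubalgebra.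

Section AffineSemigroupRings.

Definition fg_submonoid (r : nat) (S : set 'X_{1..r}) : Prop :=
  exists s : seq 'X_{1..r}, forall m : 'X_{1..r},
    S m <-> exists c : nat -> nat,
      m = (\big[+%MM/0%MM]_(i < size s) (nth 0%MM s i *+ c i))%MM.

Definition monomials (K : fieldType) (r : nat) (S : set 'X_{1..r}) :
    set {mpoly K[r]} :=
  [set f | exists2 m, S m & f = 'X_[m]].

(* A is isomorphic, as a K-algebra, to K[S] = K[X^s | s in S]. *)
Definition affine_semigroup_ring (K : fieldType) (A : lalgType K) : Prop :=
  exists (r : nat) (S : set 'X_{1..r}), fg_submonoid S /\
    exists phi : {lrmorphism A -> subalg_gen (@monomials K r S)},
      bijective phi.

End AffineSemigroupRings.

Definition normal_domain (A : idomainType) : Prop :=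
  forall x : {fraction A}, integralOver (@FracField.tofrac A) x ->
    exists a : A, x = @FracField.tofrac A a.

Section Ideals.
Variable A : comNzRingType.

(* The library's idealr_closed includes properness. *)
Definition is_prime_ideal (I : {pred A}) : Prop :=
  idealr_closed I /\ prime_idealr_closed I.

Definition is_maximal_ideal (I : {pred A}) : Prop :=
  idealr_closed I /\
  forall J : {pred A}, idealr_closed J -> {subset I <= J} -> J =i I.

Definition in_ideal (s : seq A) (x : A) : Prop :=
  exists c : nat -> A, x = \sum_(i < size s) c i * s`_i.

Definition noetherian : Prop :=
  forall I : {pred A}, idealr_closed I ->
    exists s : seq A, forall x, x \in I <-> in_ideal s x.

Definition prime_chain (n : nat) (p : nat -> {pred A}) : Prop :=
  (forall i, (i <= n)%N -> is_prime_ideal (p i)) /\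
  (forall i, (i < n)%N -> {subset p i <= p i.+1} /\ ~ {subset p i.+1 <= p i}).

Definition krull_dim (d : nat) : Prop :=
  (exists p, prime_chain d p) /\
  (forall n p, prime_chain n p -> (n <= d)%N).

Definition regular_seq (s : seq A) : Prop :=
  ~ in_ideal s 1 /\
  forall i, (i < size s)%N -> forall b : A,
    in_ideal (take i s) (s`_i * b) -> in_ideal (take i s) b.

(* The maximal length of a regular sequence contained in I. *)
Definition depth_in (I : {pred A}) (d : nat) : Prop :=
  (exists s : seq A, [/\ {subset s <= I}, regular_seq s & size s = d]) /\
  (forall s : seq A, {subset s <= I} -> regular_seq s -> (size s <= d)%N).

Definition local_cohen_macaulay : Prop :=
  exists m : {pred A},
    [/\ is_maximal_ideal m,
        forall m' : {pred A}, is_maximal_ideal m' -> m' =i m &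
        exists d : nat, depth_in m d /\ krull_dim d].

End Ideals.

Section Localization.
Variables (A : idomainType) (p : prime_idealr A).

(* A_p, as the subring {a / s | a in A, s notin p} of Frac A. *)
Definition loc_pred : {pred {fraction A}} :=
  fun x => `[< exists a s : A, s \notin (p : {pred A}) /\
                 x = @FracField.tofrac A a / @FracField.tofrac A s >].

Lemma loc_predP x :
  reflect (exists a s : A, s \notin (p : {pred A}) /\
             x = @FracField.tofrac A a / @FracField.tofrac A s)
          (x \in loc_pred).
Proof. exact: asboolP. Qed.

Lemma loc_pred_subring : GRing.subring_closed loc_pred.
Proof.
have nz s : s \notin (p : {pred A}) -> @FracField.tofrac A s != 0.
  by apply: contra; rewrite tofrac_eq0 => /eqP ->; apply: rpred0.
have nM s t : s \notin (p : {pred A}) -> t \notin (p : {pred A}) ->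
    s * t \notin (p : {pred A}).
  by move=> ps pt; rewrite prime_idealrM negb_or ps.
split.
- apply/loc_predP; exists 1, 1; rewrite tofrac1 divr1; split=> //.
  by rewrite idealr1.
- move=> _ _ /loc_predP[a [s [ps ->]]] /loc_predP[b [t [pt ->]]].
  apply/loc_predP; exists (a * t - b * s), (s * t); split; first exact: nM.
  rewrite tofracB !tofracM -mulNr addf_div ?nz // mulNr.
  by congr (_ / _); rewrite mulrC.
- move=> _ _ /loc_predP[a [s [ps ->]]] /loc_predP[b [t [pt ->]]].
  apply/loc_predP; exists (a * b), (s * t); split; first exact: nM.
  by rewrite !tofracM mulf_div.
Qed.

HB.instance Definition _ :=
  GRing.isSubringClosed.Build {fraction A} loc_pred loc_pred_subring.

Record localization := Localization {
  loc_val :> {fraction A};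
  loc_valP : loc_val \in loc_pred
}.

HB.instance Definition _ := [isSub for loc_val].
HB.instance Definition _ := [Choice of localization by <:].
HB.instance Definition _ := [SubChoice_isSubComNzRing of localization by <:].

End Localization.

Definition cohen_macaulay (A : idomainType) : Prop :=
  noetherian A /\
  forall m : prime_idealr A, is_maximal_ideal (m : {pred A}) ->
    local_cohen_macaulay (localization m).

Section DosetHibi.
Variables (disp : Order.disp_t) (H : finTBDistrLatticeType disp).

(* The bottom element satisfies this condition. *)
Definition join_irreducible (a : H) : bool :=
  [forall b : H, forall c : H,
     (a == Order.join b c) ==> (a == b) || (a == c)].

(* The set P, ordered by the restriction of the order of H. *)
Definition joinIrr : Type := {a : H | join_irreducible a}.
HB.instance Definition _ := Finite.on joinIrr.
HB.instance Definition _ := SubFinite.on joinIrr.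

Definition order_reversing (nu : {ffun joinIrr -> nat}) : bool :=
  [forall x : joinIrr, forall y : joinIrr,
     (val x <= val y)%O ==> (nu y <= nu x)%N].

Definition doset_exponent (Q : {set joinIrr}) (nu : {ffun joinIrr -> nat}) :
    bool :=
  order_reversing nu && [forall y in Q, nu y == 0 %[mod 2]].

Variable K : fieldType.

(* K[T_x | x in P], where T_x is the indeterminate of index enum_rank x. *)
Notation polyT := {mpoly K[#|{: joinIrr}|]}.

Definition Tmon (nu : {ffun joinIrr -> nat}) : polyT :=
  \prod_(x : joinIrr) 'X_(enum_rank x) ^+ nu x.

Definition doset_monomials (Q : {set joinIrr}) : set polyT :=
  [set f | exists2 nu, doset_exponent Q nu & f = Tmon nu].

Definition doset_hibi (Q : {set joinIrr}) := subalg_gen (doset_monomials Q).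

End DosetHibi.

(* Main.v *)
Require Import Defs.
From HB Require Import structures.
From mathcomp Require Import all_boot all_order all_algebra.
From mathcomp Require Import boolp classical_sets.
From mathcomp Require Import zify ring.
From mathcomp Require Import mpoly ssrcomplements.

(* Write n for the number of elements of P and S for the monoid of exponents, so
   that the ring is the monoid algebra K[S].

   Normality: if a / b is integral, then d (a / b)^k lies in K[S] for some nonzero
   d and all k.  Comparing leading exponents, lead a - lead b is almost integral
   over S, hence lies in S, and a leading term can be cancelled.

   Cohen-Macaulayness: let theta_j be the sum of T^(2 I) over the order ideals I
   with j elements.  Ordering exponents by the lexicographic order of their
   decreasing rearrangements, ties being broken by a linear extension of P, the
   leading exponent of theta_j g is obtained from that of g by adding 2 to its j
   largest entries.  Hence K[S] is free over K[theta_1, ..., theta_n] and, for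
   nonconstant one-variable polynomials f_j, over K[f_1(theta_1), ..., f_n(theta_n)];
   so these elements form a regular sequence.  By Zariski's lemma every maximal
   ideal contains such a sequence.  A regular sequence of length k yields a chain
   of primes of length k, and chains have length at most n because n + 1
   polynomials in n variables are algebraically dependent. *)

Set Implicit Arguments.
Unset Strict Implicit.
Unset Printing Implicit Defensive.

Import Order.TTheory GRing.Theory.
Local Open Scope ring_scope.

(** * Zariski's lemma *)

(** Two orders on exponents occur. Normality and the Noetherian property rest on the monomial order
    of [mlead]. For the theta_j a monomial order would add one fixed ideal per j to every exponent,
    and distinct products could then share a leading exponent. The order on decreasing
    rearrangements is not a monomial order; the ideal that it adds varies with the exponent nu and
    consists of the largest entries of nu, which form an order ideal because nu is order-reversing.
    Adding it does not change the sorting, so the shifts that can be undone are read off from the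
    gaps between consecutive entries.

    The theta_j are modelled on the sums of lattice elements of equal rank, the usual parameters of
    a Hibi ring; the factor 2 puts T^(2 I) into K[S] whatever Q is. The f_j are there because every
    maximal ideal is tested, not only the graded one, and a given one need not contain theta_j.
    Depth and dimension are both squeezed to n, so no height of a maximal ideal has to be
    computed. *)

Definition asPred (T : Type) (P : T -> Prop) : {pred T} := fun x => `[< P x >].

Lemma asPredP (T : Type) (P : T -> Prop) (x : T) : reflect (P x) (x \in asPred P).
Proof. exact: asboolP. Qed.

Section ZariskiLemma.

Definition generated_over (R L : nzRingType) (phi : R -> L) (xs : seq L) :=
  forall S : {pred L}, GRing.subring_closed S -> (forall a, phi a \in S) ->
    {subset xs <= S} -> forall y, y \in S.

(** Multiplying an integral equation of degree d for a / b by b^d leaves a^d as the only term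
    without a factor b. *)
Lemma integral_frac_dvd (R : comNzRingType) (L : fieldType)
    (phi : {rmorphism R -> L}) (a b : R) :
  injective phi -> b != 0 -> integralOver phi (phi a / phi b) ->
  exists d c, a ^+ d = b * c.
Proof.
move=> phiI b0 [p pm /eqP pr].
have pb0 : phi b != 0 by rewrite -(rmorph0 phi) (inj_eq phiI).
have [d sp] : exists d, size p = d.+1.
  by exists (size p).-1; rewrite prednK // size_poly_gt0 monic_neq0.
exists d, (- \sum_(i < d) p`_i * a ^+ i * b ^+ (d - i).-1).
apply: (phiI); rewrite mulrN rmorphN rmorphM rmorph_sum /=.
have pd : p`_d = 1 by move/monicP: pm; rewrite /lead_coef sp.
move: pr; rewrite horner_coef (size_map_inj_poly phiI (rmorph0 phi)) sp big_ord_recr /=.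
rewrite coef_map pd /= rmorph1 mul1r.
move/(congr1 (fun z => phi b ^+ d * z)); rewrite mulr0 mulrDr.
rewrite expr_div_n mulrCA divff ?expf_neq0 // mulr1.
move/eqP; rewrite addr_eq0 rmorphXn => /eqP; rewrite mulr_sumr => e.
rewrite mulr_sumr -[LHS]opprK -e; congr (- _).
apply: eq_bigr => i _; rewrite coef_map !rmorphM !rmorphXn /= expr_div_n.
have -> : phi b ^+ d = phi b ^+ i * phi b * phi b ^+ (d - i).-1.
  by rewrite -exprSr -exprD; congr (_ ^+ _); case: i => i /= /subnKC <-; lia.
by field; rewrite expf_neq0.
Qed.

Lemma root_scaled_integral (R : idomainType) (L : fieldType)
    (phi : {rmorphism R -> L}) (p : {poly R}) (x : L) :
  p != 0 -> (map_poly phi p).[x] = 0 -> integralOver phi (phi (lead_coef p) * x).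
Proof.
move=> p0 px; case sp: (size p) => [|d]; first by rewrite -size_poly_eq0 sp in p0.
have lp : lead_coef p = p`_d by rewrite /lead_coef sp.
set a := lead_coef p in lp *.
case: d sp lp => [|d] sp lp.
  move: px; rewrite (size1_polyC (eq_leq sp)) -lp map_polyC hornerC /= => /eqP.
  by move=> /eqP ->; rewrite mul0r; apply: integral0.
(* Here p has degree d + 1, and q is chosen so that q(a x) = a^d p(x). *)
pose q := \poly_(i < d.+2) (if i == d.+1 then 1 else p`_i * a ^+ (d - i)).
have sq : size q = d.+2 by apply: size_poly_eq; rewrite eqxx oner_neq0.
exists q; first by rewrite monicE /lead_coef sq coef_poly ltnSn eqxx.
apply/eqP.
rewrite (@horner_coef_wide _ d.+2); last by rewrite (leq_trans (size_poly _ _)) ?sq.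
transitivity (phi a ^+ d * (map_poly phi p).[x]); last by rewrite px mulr0.
rewrite (@horner_coef_wide _ d.+2); last by rewrite (leq_trans (size_poly _ _)) ?sp.
rewrite mulr_sumr; apply: eq_bigr => i _; rewrite !coef_map /= coef_poly ltn_ord.
rewrite exprMn mulrCA !mulrA; case: eqP => [->|/eqP ne].
  by rewrite rmorph1 mulr1 -lp exprSr.
congr (_ * _); rewrite rmorphM rmorphXn /= mulrCA -exprD mulrC; congr (_ ^+ _ * _).
by move: ne (ltn_ord i); lia.
Qed.

(** R is a domain rather than a field because the induction moves one generator into the base ring
    and applies the statement to [{poly R}]. The denominator s is common to all y; only its exponent
    varies. *)
Lemma fg_field_integral (k : nat) (R : idomainType) (L : fieldType)
    (phi : {rmorphism R -> L}) (xs : seq L) :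
  injective phi -> size xs = k -> generated_over phi xs ->
  exists2 s : R, s != 0 &
    forall y, exists N, integralOver phi (phi s ^+ N * y).
Proof.
elim: k R phi xs => [|k IH] R phi xs phiI sxs gen.
  exists 1; first exact: oner_neq0.
  move=> y; exists 0%N; rewrite mul1r.
  have : y \in asPred (fun z => exists a, phi a = z).
    apply: gen => [|a|x]; last by rewrite (size0nil sxs).
      split=> [|u v /asPredP[a <-] /asPredP[b <-]|u v /asPredP[a <-] /asPredP[b <-]].
      - by apply/asPredP; exists 1; rewrite rmorph1.
      - by apply/asPredP; exists (a - b); rewrite rmorphB.
      - by apply/asPredP; exists (a * b); rewrite rmorphM.
    by apply/asPredP; exists a.
  by move=> /asPredP[a <-]; apply: integral_id.
(* If x were transcendental over R, then L would be integral over a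
   localization R[x][1/g]; but 1 + x g is not invertible there. *)
have alg x : x \in xs -> exists2 p : {poly R}, p != 0 & (map_poly phi p).[x] = 0.
  move=> xin; apply: contrapT => nalg.
  have cfu : commr_rmorph phi x by move=> a; apply: mulrC.
  pose psi : {rmorphism {poly R} -> L} := horner_morph cfu.
  have psiE p : psi p = (map_poly phi p).[x] by [].
  have psiI : injective psi.
    apply: raddf_inj => p pp0; apply/eqP/negPn/negP => p0.
    by apply: nalg; exists p.
  have [||g g0 gint] := IH _ psi (rem x xs) psiI.
  - by rewrite size_rem // sxs.
  - move=> S Sr Sphi Sxs; apply: gen => // [a|z zin].
      by rewrite -[phi a](horner_morphC cfu); apply: Sphi.
    have [->|zx] := eqVneq z x; last by apply: Sxs; move: zin; rewrite (perm_mem (perm_to_rem xin)) inE (negPf zx).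
    by rewrite -(horner_morphX cfu); apply: Sphi.
  pose h := 1 + 'X * g.
  have sh : size h = (size g).+1.
    by rewrite /h addrC [_ * g]mulrC size_polyDl size_mulX // size_poly1 ltnS size_poly_gt0.
  have h0 : h != 0 by rewrite -size_poly_eq0 sh.
  have [N hN] := gint (psi h)^-1.
  rewrite -rmorphXn in hN; have [d [c e]] := integral_frac_dvd psiI h0 hN.
  (* Modulo h the product - X g is 1. Since h divides a power of g, it then divides 1, which its
     degree forbids. *)
  have [c' e'] : exists c', (1 - h) ^+ (N * d) = 1 - h * c'.
    elim: (N * d)%N => [|j [c' ec]]; first by exists 0; rewrite mulr0 subr0.
    by exists (c' + 1 - h * c'); rewrite exprSr ec; ring.
  have : h * (c' + (- 'X) ^+ (N * d) * c) = 1.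
    rewrite mulrDr mulrCA -e -exprM -exprMn.
    by rewrite (_ : - 'X * g = 1 - h) ?e' /h; ring.
  move/(congr1 (size : {poly R} -> nat)); set w := (c' + _).
  have [->|w0] := eqVneq w 0; first by rewrite mulr0 size_poly0 size_poly1.
  rewrite size_mul // size_poly1 sh => /eqP; rewrite addSn /= addn_eq1.
  by rewrite !size_poly_eq0 (negPf g0) (negPf w0) andbF.
have [s s0 sint] : exists2 s : R, s != 0 &
    forall x, x \in xs -> integralOver phi (phi s * x).
  elim: xs alg {gen sxs} => [|x xs IHx] alg; first by exists 1; rewrite ?oner_neq0.
  have [z zin|s s0 sP] := IHx; first by apply: alg; rewrite inE zin orbT.
  have [p p0 px] := alg x (mem_head _ _).
  exists (lead_coef p * s); first by rewrite mulf_neq0 ?lead_coef_eq0.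
  move=> z; rewrite inE rmorphM => /predU1P[->|zin].
    by rewrite mulrAC; apply: integral_mul (integral_id _ _); apply: root_scaled_integral.
  by rewrite -mulrA; apply: integral_mul (integral_id _ _) (sP _ zin).
exists s => // y.
have psN N : integralOver phi (phi s ^+ N) by rewrite -rmorphXn; apply: integral_id.
suff /asPredP : y \in asPred (fun z => exists N, integralOver phi (phi s ^+ N * z)) by [].
apply: gen => [|a|x xin].
- split=> [|u v /asPredP[M HM] /asPredP[N HN]|u v /asPredP[M HM] /asPredP[N HN]].
  + by apply/asPredP; exists 0%N; rewrite mulr1; apply: integral1.
  + apply/asPredP; exists (M + N)%N.
    rewrite mulrBr; apply: integral_sub; last first.
      by rewrite exprD -mulrA; apply: integral_mul.
    by rewrite addnC exprD -mulrA; apply: integral_mul.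
  + apply/asPredP; exists (M + N)%N.
    by rewrite exprD mulrACA; apply: integral_mul.
- by apply/asPredP; exists 0%N; rewrite mul1r; apply: integral_id.
- by apply/asPredP; exists 1%N; rewrite expr1; apply: sint.
Qed.

Lemma zariski (K L : fieldType) (phi : {rmorphism K -> L}) (xs : seq L) :
  generated_over phi xs -> integralRange phi.
Proof.
move=> gen y; have [s s0 sP] := fg_field_integral (fmorph_inj phi) erefl gen.
have [N HN] := sP y.
rewrite -[y](@mulKf _ (phi s ^+ N)) ?expf_neq0 ?fmorph_eq0 //.
apply: integral_mul HN; rewrite -rmorphXn -fmorphV; exact: integral_id.
Qed.

End ZariskiLemma.

(** * Chains of prime ideals *)

Section PrimeAvoidance.
Variable R : comNzRingType.

Definition is_ideal (J : set R) : Prop :=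
  J 0 /\ forall a u v, J u -> J v -> J (a * u + v).

Lemma is_idealM J a u : is_ideal J -> J u -> J (a * u).
Proof. by move=> [J0 JD] Ju; rewrite -[_ * _]addr0; apply: JD. Qed.

Lemma is_idealD J u v : is_ideal J -> J u -> J v -> J (u + v).
Proof. by move=> [J0 JD] Ju Jv; rewrite -[u]mul1r; apply: JD. Qed.

Lemma is_idealB J u v : is_ideal J -> J u -> J v -> J (u - v).
Proof. by move=> [J0 JD] Ju Jv; rewrite addrC -mulN1r; apply: JD. Qed.

Lemma is_ideal_closed (I : {pred R}) : idealr_closed I -> is_ideal [set x | x \in I].
Proof. by case=> I0 _ ID; split=> // a u v; apply: ID. Qed.

Lemma is_ideal_adjoin J x :
  is_ideal J -> is_ideal [set z | exists a u, J u /\ z = u + a * x].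
Proof.
move=> HJ; split; first by exists 0, 0; rewrite mul0r addr0; split=> //; case: HJ.
move=> c _ _ [a [u [Ju ->]]] [b [v [Jv ->]]].
by exists (c * a + b), (c * u + v); split; [case: HJ => _; apply | ring].
Qed.

Lemma prime_avoiding (J N : set R) :
  is_ideal J -> N 1 -> (forall x y, N x -> N y -> N (x * y)) ->
  (forall x, J x -> ~ N x) ->
  exists P : {pred R}, [/\ is_prime_ideal P, forall x, J x -> x \in P &
    forall x, N x -> x \notin P].
Proof.
move=> HJ N1 NM JN.
pose good X := [/\ is_ideal X, (J `<=` X)%classic & forall x, X x -> ~ N x].
have [F FP Ftot|M [[M0|[IM JM MN]] Mmax]] :=
    @Zorn_bigcup R (fun X => X = set0 \/ good X).
- have [[X [FX nX]]|nF] := pselect (exists X, F X /\ X <> set0); last first.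
    left; apply/seteqP; split=> // x [X FX Xx]; apply: nF; exists X; split=> // X0.
    by rewrite X0 in Xx.
  right; have gX : good X by case: (FP _ FX).
  split.
  + split; first by exists X => //; case: gX => [[]].
    move=> a u v [Y FY Yu] [Z FZ Zv].
    have gY : good Y by case: (FP _ FY) => // Y0; rewrite Y0 in Yu.
    have gZ : good Z by case: (FP _ FZ) => // Z0; rewrite Z0 in Zv.
    case: (Ftot _ _ FY FZ) => [YZ|ZY].
      by exists Z => //; case: gZ => [[_ H] _ _]; apply: H => //; apply: YZ.
    by exists Y => //; case: gY => [[_ H] _ _]; apply: H => //; apply: ZY.
  + by move=> x Jx; exists X => //; case: gX => _ JX _; apply: JX.
  + move=> x [Y FY Yx]; case: (FP _ FY) => [Y0|[_ _ YN]]; first by rewrite Y0 in Yx.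
    exact: YN.
- exfalso; apply: (Mmax J); last by right; split.
  rewrite M0; split=> // /(_ 0); case: HJ => HJ0 _; exact.
have hit x : ~ M x -> exists a u, M u /\ N (u + a * x).
  move=> nMx; apply: contrapT => nh.
  apply: (Mmax [set z | exists a u, M u /\ z = u + a * x]%classic).
    split=> [z Mz|H]; first by exists 0, z; rewrite mul0r addr0.
    by apply: nMx; apply: H; exists 1, 0; rewrite add0r mul1r; split=> //; case: IM.
  right; split; first exact: is_ideal_adjoin.
    by move=> z /JM Mz; exists 0, z; rewrite mul0r addr0.
  by move=> _ [a [u [Mu ->]]] Nz; apply: nh; exists a, u.
exists (asPred M); split; last first.
- by move=> x Nx; apply/asPredP => /MN; apply.
- by move=> x Jx; apply/asPredP; apply: JM.
split; [split|].
- by apply/asPredP; case: IM.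
- by apply/asPredP => /MN; apply.
- move=> a u v /asPredP Mu /asPredP Mv; apply/asPredP; case: IM => _; exact.
move=> u v /asPredP Muv; have [//|/asPredP nu /=] := boolP (u \in asPred M).
apply/negPn/negP => /asPredP nv.
have [a [w [Mw Nw]]] := hit _ nu; have [b [t [Mt Nt]]] := hit _ nv.
apply: (MN _ _ (NM _ _ Nw Nt)).
have -> : (w + a * u) * (t + b * v) = t * w + (b * v * w + (a * u * t + a * b * (u * v))).
  by ring.
do !apply: is_idealD => //; by [apply: is_idealM | rewrite mulrC; apply: is_idealM].
Qed.

End PrimeAvoidance.

(* The iterated boundary monoids of Coquand and Lombardi: a sequence xs lies in
   a chain of primes p_0 < p_1 < ... with xs`_i in p_(i+1) but not in p_i
   exactly when 0 is not in boundary [set 1] xs. *)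
Section Boundary.
Variable R : comNzRingType.

Fixpoint boundary (U : set R) (xs : seq R) (z : R) : Prop :=
  if xs is x :: xs' then
    exists e c w, boundary U xs' w /\ z = x ^+ e * (w + c * x)
  else U z.

Lemma boundary_sub U xs z : U z -> boundary U xs z.
Proof.
elim: xs => //= x xs IH /IH Hz.
by exists 0%N, 0, z; rewrite mul0r addr0 mul1r.
Qed.

Lemma boundaryM (U : set R) xs : (forall x y, U x -> U y -> U (x * y)) ->
  forall x y, boundary U xs x -> boundary U xs y -> boundary U xs (x * y).
Proof.
move=> UM; elim: xs => //= x xs IH _ _ [e [c [w [Hw ->]]]] [f [d [t [Ht ->]]]].
exists (e + f)%N, (c * t + d * w + c * d * x), (w * t); split; first exact: IH.
by rewrite exprD; ring.
Qed.

(** The first prime P avoids the whole boundary of x :: xs. If u + a x, with u in P, were in the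
    boundary of xs, then x u = x ((u + a x) - a x) would be in the boundary of x :: xs and in P. So
    P + (x) avoids the boundary of xs and the construction repeats. *)
Lemma boundary_prime_chain xs (J : set R) :
  is_ideal J -> (forall x, J x -> ~ boundary (eq 1) xs x) ->
  exists p, prime_chain (size xs) p /\ forall x, J x -> x \in p 0%N.
Proof.
elim: xs J => [|x xs IH] J HJ JN.
  have [|P [PP JP _]] := prime_avoiding HJ (erefl : (eq 1 : set R) 1) _ JN.
    by move=> ? ? <- <-; rewrite mulr1.
  by exists (fun=> P); split=> //; split=> // [[]].
have N1 ys : boundary (eq 1) ys 1 by apply: boundary_sub.
have UM : forall x y : R, 1 = x -> 1 = y -> 1 = x * y.
  by move=> ? ? <- <-; rewrite mulr1.
have [P [PP JP PN]] := prime_avoiding HJ (N1 _) (boundaryM UM) JN.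
have HP := is_ideal_closed PP.1.
have [|p [[pP pS] Hp]] := IH _ (is_ideal_adjoin x HP).
  move=> _ [a [u [Pu ->]]] Nz.
  have /PN/negP : boundary (eq 1) (x :: xs) (x * u).
    exists 1%N, (- a), (u + a * x); split=> //.
    by rewrite expr1 mulNr addrK.
  by apply; apply: (is_idealM x HP Pu).
exists (fun i => if i is j.+1 then p j else P); split; last exact: JP.
split=> [[|i]|[|i]] //=; [by move=> le; apply: pP| |by move=> lt; apply: pS].
move=> _; split=> [u Pu|H].
  by apply: Hp; exists 0, u; rewrite mul0r addr0.
have /PN/negP : boundary (eq 1) (x :: xs) x.
  by exists 1%N, 0, 1; rewrite mul0r addr0 expr1 mulr1.
by apply; apply: H; apply: Hp; exists 1, 0; rewrite mul1r add0r; split=> //; case: HP.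
Qed.

(** If x^e (w + c x) is in p 0, so is w + c x, because x is not; then w is in p 1, because x is.
    This is the same situation one step up the chain. *)
Lemma prime_chain_boundary (U : set R) xs p :
  prime_chain (size xs) p ->
  (forall i, (i < size xs)%N -> xs`_i \in p i.+1 /\ xs`_i \notin p i) ->
  (forall z, U z -> z \notin p (size xs)) ->
  forall z, boundary U xs z -> z \notin p 0%N.
Proof.
elim: xs p => [|x xs IH] p [pP pS] Hx HU z /=; first exact: HU.
move=> [e [c [w [Hw ->]]]]; apply/negP => H0.
have /= [x1 x0] := Hx 0%N isT.
have HM u v : u * v \in p 0%N -> (u \in p 0%N) || (v \in p 0%N) by apply: (pP 0%N isT).2.
have {H0} H0 : w + c * x \in p 0%N.
  elim: e H0 => [|e IHe]; first by rewrite mul1r.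
  by rewrite exprS -mulrA => /HM; rewrite (negPf x0).
have H1 : w + c * x \in p 1%N by apply: (pS 0%N isT).1.
have HI := is_ideal_closed (pP 1%N isT).1.
have /negP[] : w \notin p 1%N.
  apply: (IH (fun i => p i.+1)) Hw => //=; first by split=> i lt; [apply: (pP i.+1) | apply: (pS i.+1)].
  by move=> i; apply: (Hx i.+1).
by rewrite -[w](addrK (c * x)); apply: is_idealB (HI) H1 _; apply: is_idealM (HI) x1.
Qed.

Lemma in_ideal_rcons (s : seq R) x y :
  in_ideal (rcons s x) y <-> exists c, in_ideal s (y - c * x).
Proof.
split=> [[c ->]|[c [d e]]].
  exists (c (size s)), c; rewrite size_rcons big_ord_recr /= nth_rcons ltnn eqxx.
  rewrite addrK; apply: eq_bigr => i _; by rewrite nth_rcons ltn_ord.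
exists (fun i => if i == size s then c else d i).
rewrite size_rcons big_ord_recr /= eqxx nth_rcons ltnn eqxx -[LHS](subrK (c * x)) e.
congr (_ + _); apply: eq_bigr => i _; by rewrite nth_rcons ltn_ord ltn_eqF.
Qed.

(** With t the part of s already treated, regularity cancels x^e from x^e (w + c x) in (t), and w
    falls into (t, x). At the end 1 would lie in (s). *)
Lemma regular_seq_boundary (s : seq R) : regular_seq s -> ~ boundary (eq 1) s 0.
Proof.
move=> [s1 sreg].
suff H t xs z : t ++ xs = s -> in_ideal t z -> ~ boundary (eq 1) xs z.
  apply: (H [::]) => //; exists (fun=> 0); by rewrite big_ord0.
elim: xs t z => [|x xs IH] t z; first by rewrite cats0 => -> Hz /= e; rewrite -e in Hz.
move=> es Hz /= [e [c [w [Hw ez]]]]; rewrite {}ez in Hz.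
have : in_ideal t (w + c * x).
  elim: e Hz => [|e IHe]; first by rewrite mul1r.
  rewrite exprS -mulrA => Hz; apply: IHe.
  have st : take (size t) s = t by rewrite -es take_size_cat.
  have sx : s`_(size t) = x by rewrite -es nth_cat ltnn subnn.
  have := sreg (size t); rewrite st sx; apply=> //.
  by rewrite -es size_cat /= addnS ltnS leq_addr.
move=> Hwx; apply: (IH (rcons t x) w) Hw; first by rewrite cat_rcons.
by apply/in_ideal_rcons; exists (- c); rewrite mulNr opprK.
Qed.

Lemma regular_seq_prime_chain (s : seq R) :
  regular_seq s -> exists p : nat -> {pred R}, prime_chain (size s) p.
Proof.
move=> /regular_seq_boundary sN.
have [||p [? _]] := @boundary_prime_chain s (eq 0); last by exists p.
  by split=> // a u v <- <-; rewrite mulr0 addr0.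
by move=> x <-.
Qed.

End Boundary.

(** * Dimension of subrings of polynomial rings *)

Section AlgebraicDependence.

(** The value at xs of a polynomial of degree below D in each variable, [c] giving the coefficient
    for each list of exponents. The recursion on the variables follows that of [boundary];
    [comb_tuples] is the flat form used for linear algebra. *)
Fixpoint comb (K A : nzRingType) (phi : K -> A) (D : nat) (xs : seq A)
    (c : seq nat -> K) : A :=
  if xs is x :: xs' then
    \sum_(j < D) x ^+ j * comb phi D xs' (fun l => c (val j :: l))
  else phi (c [::]).

Definition nonzero_on (K : nzRingType) (D k : nat) (c : seq nat -> K) : Prop :=
  exists l, [/\ size l = k, all (ltn^~ D) l & c l != 0].

Lemma comb0 (K A : nzRingType) (phi : {rmorphism K -> A}) D xs c :
  ~ nonzero_on D (size xs) c -> comb phi D xs c = 0.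
Proof.
elim: xs c => [|x xs IH] c Hc /=.
  have [->|c0] := eqVneq (c [::]) 0; first by rewrite rmorph0.
  by case: Hc; exists [::].
rewrite big1 // => j _; rewrite IH ?mulr0 // => -[l [sl lD cl]].
by apply: Hc; exists (val j :: l); split; rewrite //= ?sl ?ltn_ord.
Qed.

(** Take out the lowest power of x with a nonzero coefficient polynomial. That coefficient plays the
    role of w in the boundary, and the higher powers supply c x. An algebraic relation among the xs
    therefore puts 0 into the boundary. *)
Lemma comb_boundary (K : fieldType) (A : comNzRingType) (phi : {rmorphism K -> A})
    D xs c :
  nonzero_on D (size xs) c ->
  boundary [set z | exists2 a, a != 0 & z = phi a]%classic xs (comb phi D xs c).
Proof.
set U := (X in boundary X); elim: xs c => [|x xs IH] c /=.
  by case=> -[|? ?] [] // _ _ c0; exists (c [::]).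
case=> -[|j0 l0] [] //= [sl] /andP[j0D lD] c0.
suff H D' (y : nat -> A) : (exists2 j, (j < D')%N & boundary U xs (y j)) ->
    (forall j, y j = 0 \/ boundary U xs (y j)) ->
    boundary U (x :: xs) (\sum_(j < D') x ^+ j * y j).
  apply: (H D (fun j => comb phi D xs (fun l => c (j :: l)))).
    by exists j0 => //; apply: IH; exists l0.
  move=> j; have [/IH ?|/comb0 ?] := pselect (nonzero_on D (size xs) (fun l => c (j :: l))).
    by right.
  by left.
elim: D' y => [|D' IHD] y; first by case.
move=> [j jD jb] yP; rewrite big_ord_recl mul1r.
have -> : \sum_(i < D') x ^+ bump 0 i * y (bump 0 i) =
    x * \sum_(i < D') x ^+ i * y i.+1.
  by rewrite mulr_sumr; apply: eq_bigr => i _; rewrite mulrA -exprS.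
have [y0|ny0] := pselect (boundary U xs (y 0%N)).
  by exists 0%N; eexists; exists (y 0%N); split; [|rewrite mul1r mulrC].
have y0 : y 0%N = 0 by case: (yP 0%N).
case: j jD jb => // j jD jb.
have [||e [d [w [Hw ->]]]] := IHD (fun i => y i.+1); first by exists j.
  by move=> i; apply: yP.
by exists e.+1, d, w; rewrite y0 add0r exprS mulrA.
Qed.

Lemma comb_tuples (K : nzRingType) (A : comNzRingType) (phi : {rmorphism K -> A})
    D xs c :
  comb phi D xs c = \sum_(t : (size xs).-tuple 'I_D)
    phi (c (map val t)) * \prod_(i < size xs) xs`_i ^+ tnth t i.
Proof.
elim: xs c => [|x xs IH] c /=.
  rewrite (big_pred1 [tuple]) => [|t]; first by rewrite big_ord0 mulr1.
  by apply/esym/eqP; apply: tuple0.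
pose h (p : 'I_D * (size xs).-tuple 'I_D) := cons_tuple p.1 p.2.
rewrite (reindex h) /=; last first.
  exists (fun t => (thead t, behead_tuple t)) => [[a t] _|t _] /=.
    by congr (_, _); apply: val_inj.
  by rewrite [RHS]tuple_eta; apply: val_inj.
under eq_bigr => j _ do rewrite IH mulr_sumr.
rewrite pair_big; apply: eq_bigr => -[j t] _ /=.
rewrite big_ord_recl /= mulrCA; congr (_ * (_ * _)).
by apply: eq_bigr => i _; rewrite tnthS.
Qed.

Lemma comb_morph (K : nzRingType) (A B : nzRingType) (phi : K -> A)
    (f : {rmorphism A -> B}) D xs c :
  f (comb phi D xs c) = comb (f \o phi) D (map f xs) c.
Proof.
elim: xs c => //= x xs IH c; rewrite rmorph_sum; apply: eq_bigr => j _.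
by rewrite rmorphM rmorphXn IH.
Qed.

Lemma msize_prod_exp (K : fieldType) (n : nat) (I : Type) (r : seq I)
    (x : I -> {mpoly K[n]}) (e : I -> nat) (E D : nat) :
  (forall i, msize (x i) <= E.+1)%N -> (forall i, e i <= D)%N ->
  (msize (\prod_(i <- r) x i ^+ e i) <= (size r * (D * E)).+1)%N.
Proof.
move=> xE eD.
have M (p q : {mpoly K[n]}) a b : (msize p <= a.+1 -> msize q <= b.+1 ->
    msize (p * q) <= (a + b).+1)%N.
  move=> pa qb.
  have [->|p0] := eqVneq p 0; first by rewrite mul0r msize0.
  have [->|q0] := eqVneq q 0; first by rewrite mulr0 msize0.
  rewrite msizeM //; move: (msize p) (msize q) pa qb => s t; lia.
elim: r => [|i r IH]; first by rewrite big_nil msize1.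
rewrite big_cons /= mulSn; apply: (M) IH.
have : (msize (x i ^+ e i) <= (e i * E).+1)%N.
  elim: (e i) => [|k IHk]; first by rewrite msize1.
  by rewrite exprS mulSn; apply: M.
by move/leq_trans; apply; rewrite ltnS leq_mul2r eD orbT.
Qed.

(* Linear algebra: the D ^ size xs monomials of exponents below D in the xs lie in
   a space of dimension at most ((size xs * E) * D + 1) ^ n. *)
Lemma algebraic_dependence (K : fieldType) (n : nat) (xs : seq {mpoly K[n]}) :
  (n < size xs)%N ->
  exists D c, nonzero_on D (size xs) c /\ comb (@mpolyC n K) D xs c = 0.
Proof.
move=> nk; set k := size xs in nk *.
pose E := \max_(i < k) msize xs`_i.
have xE (i : 'I_k) : (msize xs`_i <= E.+1)%N.
  by rewrite leqW // (@leq_bigmax _ (fun i : 'I_k => msize xs`_i)).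
(* These values give k D E + 1 <= b D and b^n < D, so the exponents that can occur number at most (b
   D)^n < D^(n + 1) <= D^k. *)
pose b := (k * (k * E)).+1; pose D := (b ^ n).+1.
pose T := k.-tuple 'I_D; pose C := {ffun 'I_n -> 'I_((k * (D * E)).+1)}.
have CT : (#|{: C}| < #|{: T}|)%N.
  rewrite card_ffun card_tuple !card_ord.
  apply: (@leq_ltn_trans ((b * D) ^ n)); last first.
    rewrite expnMn (@leq_trans (D ^ n.+1)) ?leq_pexp2l // expnS ltn_pmul2r //.
    by rewrite expn_gt0.
  case: (n) => // n'; rewrite leq_exp2r // /b mulSn.
  have : (k * (D * E) <= k * (k * E) * D)%N by rewrite -mulnA leq_mul2l [(k * E * D)%N]mulnC leq_mul2l; case: (k) => [|k'] //; rewrite ?leq_pmull ?orbT.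
  by rewrite -ltnS; move/leq_trans; apply; rewrite addnC -addn1 leq_add2l.
pose mon (t : T) := \prod_(i < k) xs`_i ^+ tnth t i.
pose mm (g : C) : 'X_{1..n} := [multinom val (g i) | i < n].
pose M : 'M[K]_(#|{: T}|, #|{: C}|) :=
  \matrix_(i, j) (mon (enum_val i))@_(mm (enum_val j)).
have [v v0 vM] : exists2 v : 'rV_ #|{: T}|, v != 0 & v *m M = 0.
  have : kermx M != 0.
    by rewrite -mxrank_eq0 mxrank_ker -lt0n subn_gt0 (leq_ltn_trans (rank_leq_col M)).
  case/rowV0Pn => v /sub_kermxP vM v0; by exists v.
pose c (l : seq nat) := if [pick t : T | map val t == l] is Some t then v 0 (enum_rank t) else 0.
have cE (t : T) : c (map val t) = v 0 (enum_rank t).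
  rewrite /c; case: pickP => [u /eqP /(inj_map val_inj) /val_inj -> //|/(_ t)].
  by rewrite eqxx.
exists D, c; split.
  have [i vi] : exists i, v 0 i != 0.
    apply/existsP; rewrite -negb_forall; apply: contra v0 => /forallP H.
    by apply/eqP/rowP => i; rewrite mxE; apply/eqP.
  exists (map val (enum_val i)); split; last by rewrite cE enum_valK.
    by rewrite size_map size_tuple.
  by apply/allP => _ /mapP[j _ ->]; apply: ltn_ord.
rewrite -[mpolyC n (R:=K)]/(GRing.RMorphism.sort (mpolyC n (R:=K))) comb_tuples -/k.
set P := \sum_t _.
have Psz : (msize P <= (k * (D * E)).+1)%N.
  apply: (leq_trans (msize_sum _ _ _)); apply/bigmax_leqP => t _.
  rewrite mul_mpolyC; apply: (leq_trans (msizeZ_le _ _)).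
  have := @msize_prod_exp K n 'I_k (index_enum 'I_k) (fun i => xs`_i) (fun i => tnth t i) E D xE.
  rewrite /index_enum -enumT size_enum_ord; apply=> i; exact: ltnW.
apply/mpolyP => m; rewrite mcoeff0.
have [mlt|] := ltnP (mdeg m) (k * (D * E)).+1; last first.
  by move=> le; apply: memN_msupp_eq0; apply: msize_mdeg_ge; apply: leq_trans le.
have mi i : (m i < (k * (D * E)).+1)%N.
  by apply: leq_ltn_trans mlt; rewrite mdegE (bigD1 i) //= leq_addr.
pose g : C := [ffun i => Ordinal (mi i)].
have -> : m = mm g by apply/mnmP => i; rewrite mnmE ffunE.
move/rowP/(_ (enum_rank g)): vM; rewrite !mxE => <-.
rewrite raddf_sum (reindex (fun i : 'I_#|{: T}| => enum_val i)) /=; last exact/onW_bij/enum_val_bij.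
by apply: eq_bigr => i _; rewrite mul_mpolyC mcoeffZ cE enum_valK mxE enum_rankK.
Qed.

(** Pick an element in each difference of successive primes. More than n of them satisfy an
    algebraic relation over K, which puts 0 into their boundary over the nonzero constants; these
    are units and so avoid the last prime, against [prime_chain_boundary]. *)
Lemma prime_chain_leq (K : fieldType) (n : nat) (A : comNzRingType)
    (phi : {rmorphism K -> A}) (f : {rmorphism A -> {mpoly K[n]}}) :
  injective f -> (forall a, f (phi a) = a%:MP) ->
  forall k (p : nat -> {pred A}), prime_chain k p -> (k <= n)%N.
Proof.
move=> fI fphi k p [pP pS]; rewrite leqNgt; apply/negP => nk.
have /choice[x xP] : forall i, exists x, (i < k)%N -> x \in p i.+1 /\ x \notin p i.
  move=> i; have [lt|] := ltnP i k; last by exists 0.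
  have [_ nsub] := pS i lt; apply: contrapT => nex; apply: nsub => x xi.
  by apply/negPn/negP => nxi; apply: nex; exists x.
pose xs := [seq x i | i <- iota 0 k].
have sxs : size xs = k by rewrite size_map size_iota.
have nxs i : (i < k)%N -> xs`_i = x i.
  by move=> lt; rewrite (nth_map 0%N) ?size_iota // nth_iota.
have [|D [c [c0 e]]] := @algebraic_dependence K n (map f xs).
  by rewrite size_map sxs.
rewrite size_map in c0.
have b0 : boundary [set z | exists2 a, a != 0 & z = phi a]%classic xs 0.
  suff <- : comb phi D xs c = 0 by apply: comb_boundary.
  apply: fI; rewrite comb_morph rmorph0 -e; congr comb.
  by apply/funext => a; apply: fphi.
have p0 : 0 \in p 0%N by case: (pP 0%N isT) => [[]].
suff : 0 \notin p 0%N by rewrite p0.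
apply: prime_chain_boundary b0; rewrite sxs; first by split.
  by move=> i lt; rewrite nxs //; apply: xP.
move=> _ [a a0 ->]; have [[_ p1 pD] _] := pP k (leqnn k).
apply/negP => pa; case/negP: p1.
have := is_idealM (phi a^-1) (is_ideal_closed (pP k (leqnn k)).1) pa.
by rewrite /= -rmorphM mulVf // rmorph1.
Qed.

End AlgebraicDependence.

(** * Localization at a maximal ideal *)

Section LocalCohenMacaulay.
Variables (A : comNzRingType) (m : {pred A}) (L : comNzRingType).
Variable j : {rmorphism A -> L}.
Hypothesis m_prime : is_prime_ideal m.
Hypothesis jI : injective j.
Hypothesis j_unit : forall s, s \notin m -> exists t, j s * t = 1.
Hypothesis j_surj : forall x, exists a s, s \notin m /\ x * j s = j a.

Let mI : is_ideal [set x | x \in m] := is_ideal_closed m_prime.1.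

Let mN s t : s \notin m -> t \notin m -> s * t \notin m.
Proof.
by move=> sm tm; apply/negP => /m_prime.2; rewrite (negPf sm) (negPf tm).
Qed.

Let m1 : 1 \notin m. Proof. by case: m_prime => [[]]. Qed.

Let locmax : {pred L} :=
  asPred (fun x => exists a s, [/\ a \in m, s \notin m & x * j s = j a]).

Lemma local_maximal_j a : (j a \in locmax) = (a \in m).
Proof.
apply/asPredP/idP => [[b [s [bm sm]]]|am]; last first.
  by exists a, 1; rewrite rmorph1 mulr1.
rewrite -rmorphM => /jI e; rewrite -e in bm.
by case/orP: (m_prime.2 _ _ bm) => //; rewrite (negPf sm).
Qed.

Lemma local_maximal_closed : idealr_closed locmax.
Proof.
split.
- by rewrite -(rmorph0 j) local_maximal_j; case: m_prime => [[]].
- by rewrite -(rmorph1 j) local_maximal_j.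
move=> c x y /asPredP[a [s [am sm e]]] /asPredP[b [t [bm tm f]]].
have [d [u [um g]]] := j_surj c.
apply/asPredP; exists (d * a * t + b * u * s), (u * s * t); split.
- apply: (is_idealD mI).
    by rewrite /= mulrC; apply: (is_idealM _ mI); apply: (is_idealM _ mI).
  by rewrite /= -mulrA mulrC; apply: (is_idealM _ mI).
- by rewrite !mN.
rewrite !rmorphD !rmorphM -g -e -f; ring.
Qed.

Lemma proper_sub_local_maximal (I : {pred L}) :
  idealr_closed I -> {subset I <= locmax}.
Proof.
move=> HI x xI; have [a [s [sm e]]] := j_surj x.
apply/asPredP; exists a, s; split=> //; apply/negPn/negP => /j_unit[t ht].
case: (HI) => _ /negP[]; rewrite -ht -e mulrC.
apply: (is_idealM t (is_ideal_closed HI)).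
by rewrite /= mulrC; apply: (is_idealM _ (is_ideal_closed HI)).
Qed.

Lemma local_maximalP : is_maximal_ideal locmax.
Proof.
split=> [|J HJ sub x]; first exact: local_maximal_closed.
apply/idP/idP; last exact: sub.
exact: proper_sub_local_maximal.
Qed.

Lemma local_maximal_uniq m' : is_maximal_ideal m' -> m' =i locmax.
Proof.
move=> [m'I m'max] x; rewrite (m'max locmax) //; first exact: local_maximal_closed.
exact: proper_sub_local_maximal.
Qed.

(** Induction on t replaces the choice of a common denominator for all coefficients. *)
Lemma in_ideal_local (t : seq A) x :
  in_ideal (map j t) x <-> exists a u, [/\ u \notin m, x * j u = j a & in_ideal t a].
Proof.
elim/last_ind: t x => [|t y IH] x.
  split=> [[c ->]|[a [u [um e [c ha]]]]].
    exists 0, 1; rewrite rmorph0 big_ord0 mul0r; split=> //.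
    by exists (fun=> 0); rewrite big_ord0.
  exists (fun=> 0); rewrite big_ord0; have [v hv] := j_unit um.
  by rewrite -[x]mulr1 -hv mulrA e ha big_ord0 rmorph0 mul0r.
rewrite map_rcons; split.
  move/in_ideal_rcons => [c /IH[a [u [um e ha]]]].
  have [d [v [vm g]]] := j_surj c.
  exists (a * v + d * u * y), (u * v); split; first exact: mN.
    rewrite rmorphD !rmorphM -e -g; ring.
  apply/in_ideal_rcons; exists (d * u); rewrite addrK.
  by case: ha => [f ->]; exists (fun i => f i * v); rewrite mulr_suml; apply: eq_bigr => i _; ring.
move=> [a [u [um e /in_ideal_rcons[c hc]]]]; apply/in_ideal_rcons.
have [v hv] := j_unit um.
exists (j c * v); apply/IH; exists (a - c * y), u; split=> //.
rewrite mulrBl e rmorphB rmorphM; congr (_ - _).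
by rewrite -[RHS]mulr1 -hv; ring.
Qed.

Lemma regular_seq_local (s : seq A) : {subset s <= m} -> regular_seq s ->
  regular_seq (map j s) /\ {subset map j s <= locmax}.
Proof.
move=> sm [_ sreg].
have sub : {subset map j s <= locmax}.
  by move=> _ /mapP[a /sm am ->]; rewrite local_maximal_j.
split=> //; split=> [[c e]|i].
  case: local_maximal_closed => _ /negP[]; rewrite e.
  apply: (@big_ind _ (fun x => x \in locmax : Prop)) => [|x y xM yM|i _].
  - by case: local_maximal_closed.
  - exact: (is_idealD (is_ideal_closed local_maximal_closed)).
  - by apply: (is_idealM _ (is_ideal_closed local_maximal_closed)); apply/sub/mem_nth.
rewrite size_map => lt b; rewrite -map_take (nth_map 0) // => /in_ideal_local.
move=> [a [u [um e ha]]]; apply/in_ideal_local.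
have [b' [v [vm g]]] := j_surj b.
exists (b' * u), (v * u); split; [exact: mN| by rewrite !rmorphM mulrA g|].
apply: sreg => //.
have -> : s`_i * (b' * u) = a * v.
  by apply: jI; rewrite !rmorphM -e -g; ring.
by case: ha => [f ->]; exists (fun i => f i * v); rewrite mulr_suml; apply: eq_bigr => k _; ring.
Qed.

Lemma prime_chain_contract k (p : nat -> {pred L}) :
  prime_chain k p -> prime_chain k (fun i => asPred (fun a => j a \in p i)).
Proof.
move=> [pP pS]; split=> i lt.
  have [[p0 p1 pD] pM] := pP i lt; split; [split|].
  - by apply/asPredP; rewrite rmorph0.
  - by apply/asPredP; rewrite rmorph1; apply/negP.
  - move=> a u v /asPredP pu /asPredP pv; apply/asPredP.
    by rewrite rmorphD rmorphM; apply: pD.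
  - move=> u v /asPredP; rewrite rmorphM => /pM /orP[pu|pv]; apply/orP; [left|right];
    exact/asPredP.
have [sub nsub] := pS i lt; split=> [a /asPredP pa|H].
  by apply/asPredP/sub.
apply: nsub => x xp; have [a [s [sm e]]] := j_surj x.
have /H/asPredP ja : a \in asPred (fun a => j a \in p i.+1).
  apply/asPredP; rewrite -e mulrC.
  exact: (is_idealM _ (is_ideal_closed (pP i.+1 lt).1)).
have [t ht] := j_unit sm; rewrite -[x]mulr1 -ht mulrA e mulrC.
exact: (is_idealM _ (is_ideal_closed (pP i (ltnW lt)).1)).
Qed.

(** Regular sequences in L give prime chains of L, and these contract to prime chains of A; so
    [size s] bounds depth and dimension. The image of s attains both bounds. *)
Lemma local_cohen_macaulay_intro (s : seq A) :
  {subset s <= m} -> regular_seq s ->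
  (forall k (p : nat -> {pred A}), prime_chain k p -> (k <= size s)%N) ->
  local_cohen_macaulay L.
Proof.
move=> sm sreg dimA; have [jreg jsub] := regular_seq_local sm sreg.
have dimL k (p : nat -> {pred L}) : prime_chain k p -> (k <= size s)%N.
  by move/prime_chain_contract/dimA.
exists locmax; split; [exact: local_maximalP|exact: local_maximal_uniq|].
exists (size s); split; split=> //.
- by exists (map j s); rewrite size_map.
- by move=> t _ /regular_seq_prime_chain[p /dimL].
- by rewrite -(size_map j); apply: regular_seq_prime_chain.
Qed.

End LocalCohenMacaulay.

Section Localization.
Variables (A : idomainType) (p : prime_idealr A).

Lemma to_loc_subproof a : FracField.tofrac a \in loc_pred p.
Proof.
by apply/loc_predP; exists a, 1; rewrite idealr1 tofrac1 divr1.
Qed.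

Definition to_loc a : localization p := Localization (to_loc_subproof a).

Lemma to_loc_zmod : zmod_morphism to_loc.
Proof. by move=> x y; apply: val_inj; rewrite /= tofracB. Qed.

Lemma to_loc_monoid : monoid_morphism to_loc.
Proof. by split=> [|x y]; apply: val_inj; rewrite /= ?tofrac1 ?tofracM. Qed.

HB.instance Definition _ := GRing.isZmodMorphism.Build A (localization p) to_loc to_loc_zmod.
HB.instance Definition _ := GRing.isMonoidMorphism.Build A (localization p) to_loc to_loc_monoid.

Lemma loc_pred_neq0 s : s \notin (p : {pred A}) -> FracField.tofrac s != 0.
Proof. by apply: contra; rewrite tofrac_eq0 => /eqP ->; apply: rpred0. Qed.

Lemma localization_cohen_macaulay (s : seq A) :
  {subset s <= (p : {pred A})} -> regular_seq s ->
  (forall k (q : nat -> {pred A}), prime_chain k q -> (k <= size s)%N) ->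
  local_cohen_macaulay (localization p).
Proof.
apply: (@local_cohen_macaulay_intro _ _ _ to_loc).
- split; last by move=> u v; rewrite prime_idealrM.
  split; [exact: rpred0|by rewrite idealr1|].
  by move=> a u v pu pv; rewrite rpredD ?idealMr.
- by move=> x y /(congr1 val) /= /eqP; rewrite tofrac_eq => /eqP.
- move=> t tp; have iP : (FracField.tofrac t)^-1 \in loc_pred p.
    by apply/loc_predP; exists 1, t; rewrite tofrac1 div1r.
  exists (Localization iP); apply: val_inj; rewrite /= divff //.
  exact: loc_pred_neq0.
- case=> x xP; have /loc_predP[a [t [tp e]]] := xP.
  exists a, t; split=> //; apply: val_inj; rewrite /= e divfK //.
  exact: loc_pred_neq0.
Qed.

End Localization.

(** * Exponents sorted by decreasing weight *)

Section SortedExponents.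
Variables (n M : nat) (r : 'I_n -> nat).
Hypothesis r_inj : injective r.
Hypothesis r_lt : forall x, (r x < M)%N.
Implicit Types (nu mu : 'X_{1..n}) (x y : 'I_n) (j k : 'I_n).

Let M_gt0 x : (0 < M)%N := leq_ltn_trans (leq0n _) (r_lt x).

(* Sorting by weight is sorting by nu, ties being broken by the labels r. *)
Definition wgt nu x : nat := (nu x * M + r x)%N.

Lemma wgt_mod nu x : (wgt nu x %% M)%N = r x.
Proof. by rewrite /wgt modnMDl modn_small. Qed.

Lemma wgt_div nu x : (wgt nu x %/ M)%N = nu x.
Proof. by rewrite /wgt divnMDl ?(M_gt0 x) // divn_small // addn0. Qed.

Lemma wgt_inj2 nu mu x y : wgt nu x = wgt mu y -> x = y.
Proof. by move/(congr1 (modn^~ M)); rewrite !wgt_mod => /r_inj. Qed.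

Definition wseq nu : seq 'I_n := sort (fun x y => wgt nu y <= wgt nu x)%N (enum 'I_n).

Lemma size_wseq nu : size (wseq nu) = n.
Proof. by rewrite size_sort size_enum_ord. Qed.

Lemma mem_wseq nu x : x \in wseq nu.
Proof. by rewrite mem_sort mem_enum. Qed.

Lemma wseq_uniq nu : uniq (wseq nu).
Proof. by rewrite sort_uniq enum_uniq. Qed.

Definition pos nu x : nat := index x (wseq nu).

Lemma pos_lt nu x : (pos nu x < n)%N.
Proof. by have := mem_wseq nu x; rewrite -index_mem size_wseq. Qed.

Definition wnth nu (j : 'I_n) : 'I_n := tnth (Tuple (introT eqP (size_wseq nu))) j.

Lemma pos_wnth nu j : pos nu (wnth nu j) = j.
Proof.
by rewrite /pos /wnth (tnth_nth j) /= index_uniq ?wseq_uniq ?size_wseq.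
Qed.

Lemma wnth_pos nu x : wnth nu (Ordinal (pos_lt nu x)) = x.
Proof. by rewrite /wnth (tnth_nth x) /= nth_index ?mem_wseq. Qed.

Lemma wnth_inj nu : injective (wnth nu).
Proof. by move=> j k /(congr1 (pos nu)); rewrite !pos_wnth => /val_inj. Qed.

Lemma wgt_lt_wnth nu j k : (j < k)%N -> (wgt nu (wnth nu k) < wgt nu (wnth nu j))%N.
Proof.
move=> lt; rewrite ltn_neqAle; apply/andP; split.
  by apply/eqP => /wgt_inj2/wnth_inj e; rewrite e ltnn in lt.
rewrite /wnth !(tnth_nth j) /=.
have : sorted (fun x y => wgt nu y <= wgt nu x)%N (wseq nu).
  by apply: sort_sorted => x y; apply: leq_total.
move/(sorted_leq_nth _ _ j); apply; rewrite ?inE ?size_wseq ?ltn_ord // 1?ltnW //.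
by move=> x y z h1 h2; apply: leq_trans h2 h1.
Qed.

Lemma wgt_ltE nu x y : (wgt nu x < wgt nu y)%N = (pos nu y < pos nu x)%N.
Proof.
rewrite -{1}(wnth_pos nu x) -{1}(wnth_pos nu y).
have [lt|gt|e] := ltngtP (pos nu y) (pos nu x).
- exact: wgt_lt_wnth.
- by apply/negbTE; rewrite -leqNgt ltnW // wgt_lt_wnth.
- by rewrite (_ : Ordinal _ = Ordinal (pos_lt nu y)) ?ltnn //; apply: val_inj.
Qed.

Lemma wgt_leE nu x y : (wgt nu x <= wgt nu y)%N = (pos nu y <= pos nu x)%N.
Proof. by rewrite leqNgt wgt_ltE -leqNgt. Qed.

Lemma eq_wseq nu mu : (forall x y, wgt nu x < wgt nu y -> wgt mu x < wgt mu y)%N ->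
  wseq mu = wseq nu.
Proof.
move=> H; rewrite /wseq; congr (sort _ _); apply/funext => x; apply/funext => y.
have [lt|gt|e] := ltngtP (wgt nu y) (wgt nu x).
- by apply: ltnW; apply: H.
- by apply/negbTE; rewrite -ltnNge; apply: H.
- by rewrite (wgt_inj2 e) leqnn.
Qed.

Definition wvec nu : n.-tuplelexi nat := [tuple wgt nu (wnth nu k) | k < n].

Lemma wvec_ltP nu mu : reflect
  (exists2 k : 'I_n, forall i : 'I_n, (i < k)%N -> wgt nu (wnth nu i) = wgt mu (wnth mu i)
     & (wgt nu (wnth nu k) < wgt mu (wnth mu k))%N)
  (wvec nu < wvec mu)%O.
Proof.
apply: (iffP idP) => [/ltxi_tuplePlt|] [k eqk ltk]; [|apply/ltxi_tuplePlt]; exists k.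
- by move=> i /eqk; rewrite !tnth_mktuple.
- by move: ltk; rewrite !tnth_mktuple.
- by move=> i /eqk; rewrite !tnth_mktuple.
- by rewrite !tnth_mktuple.
Qed.

(** A weight modulo M is a label and determines the element; its quotient by M is the entry
    there. *)
Lemma wvec_inj : injective wvec.
Proof.
move=> nu mu e; apply/mnmP => x.
have H k : wgt nu (wnth nu k) = wgt mu (wnth mu k).
  by move/(congr1 (fun t => tnth t k)): e; rewrite !tnth_mktuple.
have := H (Ordinal (pos_lt nu x)); rewrite wnth_pos => {}H.
by rewrite -(wgt_div nu x) H -(wgt_inj2 H) wgt_div.
Qed.

Definition shift (d : nat) j nu : 'X_{1..n} :=
  [multinom nu x + d * (pos nu x <= j) | x < n].

Lemma shiftE d j nu x : shift d j nu x = (nu x + d * (pos nu x <= j))%N.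
Proof. by rewrite mnmE. Qed.

Lemma wgt_shift d j nu x : wgt (shift d j nu) x = (wgt nu x + d * M * (pos nu x <= j))%N.
Proof. by rewrite /wgt shiftE; lia. Qed.

(** The raised elements form an initial segment of the sorting, so a larger weight is raised at
    least as much. That shifts keep the sorting is what makes them add up in [shiftD] and act on
    separate gaps in [gap_shift]. *)
Lemma wgt_shift_lt d j nu x y : (wgt nu x < wgt nu y)%N ->
  (wgt (shift d j nu) x < wgt (shift d j nu) y)%N.
Proof.
move=> lt; rewrite !wgt_shift; apply: (leq_trans (n := (wgt nu y + d * M * (pos nu x <= j))%N)).
  by rewrite ltn_add2r.
rewrite leq_add2l leq_mul2l; rewrite wgt_ltE in lt; apply/orP; right.
by case: (leqP (pos nu x) j) => // le; rewrite (leq_trans (ltnW lt) le).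
Qed.

Lemma wseq_shift d j nu : wseq (shift d j nu) = wseq nu.
Proof. by apply: eq_wseq => x y; apply: wgt_shift_lt. Qed.

Lemma pos_shift d j nu : pos (shift d j nu) = pos nu.
Proof. by rewrite /pos wseq_shift. Qed.

Lemma wnth_shift d j nu : wnth (shift d j nu) = wnth nu.
Proof.
by apply/funext => k; rewrite -[RHS](wnth_pos (shift d j nu)); congr wnth;
   apply: val_inj; rewrite /= pos_shift pos_wnth.
Qed.

Lemma shiftD d d' j nu : shift d j (shift d' j nu) = shift (d + d') j nu.
Proof. by apply/mnmP => x; rewrite !shiftE pos_shift; lia. Qed.

Lemma shift0 j nu : shift 0 j nu = nu.
Proof. by apply/mnmP => x; rewrite shiftE addn0. Qed.

Lemma wgt_wnth_shift d j nu k :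
  wgt (shift d j nu) (wnth (shift d j nu) k) = (wgt nu (wnth nu k) + d * M * (k <= j))%N.
Proof. by rewrite wnth_shift wgt_shift pos_wnth. Qed.

(** Adding the same exponent on both sides need not preserve the order: (2, 0) exceeds (1, 1), yet
    after adding (0, 2) the result (2, 2) is below (1, 3). A shift adds the same amounts to the same
    positions of both sorted sequences. *)
Lemma wvec_shift_lt d j nu mu :
  (wvec nu < wvec mu)%O -> (wvec (shift d j nu) < wvec (shift d j mu))%O.
Proof.
move=> /wvec_ltP[k eqk ltk]; apply/wvec_ltP; exists k => [i ik|].
  by rewrite !wgt_wnth_shift eqk.
by rewrite !wgt_wnth_shift ltn_add2r.
Qed.

Lemma wvec_lt_shift d d' j nu : (d < d')%N ->
  (wvec (shift d j nu) < wvec (shift d' j nu))%O.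
Proof.
move=> lt; have n0 : (0 < n)%N := leq_ltn_trans (leq0n _) (ltn_ord j).
apply/wvec_ltP; exists (Ordinal n0) => //.
by rewrite !wgt_wnth_shift /= !muln1 ltn_add2l ltn_mul2r lt (M_gt0 j).
Qed.

Lemma shift_inj d j : injective (shift d j).
Proof.
move=> nu mu e; apply: wvec_inj; case: (ltgtP (wvec nu) (wvec mu)) => // lt;
by have := wvec_shift_lt d j lt; rewrite e ltxx.
Qed.

Definition top j nu : {set 'I_n} := [set x | pos nu x <= j]%N.

Definition indicator (d : nat) (I : {set 'I_n}) : 'X_{1..n} :=
  [multinom d * (x \in I) | x < n].

Lemma shift_top d j nu : shift d j nu = (nu + indicator d (top j nu))%MM.
Proof. by apply/mnmP => x; rewrite shiftE mnmDE mnmE inE. Qed.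

Lemma top_wnth j nu : top j nu = [set wnth nu k | k : 'I_n & (k <= j)%N].
Proof.
apply/setP => x; rewrite inE; apply/idP/imsetP => [le|[k]].
  by exists (Ordinal (pos_lt nu x)); rewrite ?wnth_pos // inE.
by rewrite inE => le ->; rewrite pos_wnth.
Qed.

Lemma card_top j nu : #|top j nu| = j.+1.
Proof.
rewrite top_wnth card_imset; last exact: wnth_inj.
rewrite -sum1_card (eq_bigl (fun k : 'I_n => k < j.+1)%N) => [|k]; last by rewrite inE.
by rewrite -(big_ord_widen n (fun=> 1%N)) ?ltn_ord // sum_nat_const card_ord muln1.
Qed.

(* Comparing the decreasing rearrangements of the weights at their first
   difference: the top j.+1 elements of nu are the optimal ones to increase. *)
Lemma wvec_add_indicator d j nu (I : {set 'I_n}) : #|I| = j.+1 ->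
  (wvec (nu + indicator d I)%MM <= wvec (shift d j nu))%O.
Proof.
move=> cI; rewrite leNgt; apply/negP => /wvec_ltP[k eqk].
set mu := (nu + indicator d I)%MM in eqk *.
have wmu x : wgt mu x = (wgt nu x + d * M * (x \in I))%N.
  by rewrite /wgt mnmDE mnmE; lia.
have {}eqk (i : 'I_n) : (i < k)%N ->
    wnth mu i = wnth nu i /\ (d * M * (i <= j) = d * M * (wnth nu i \in I))%N.
  move=> /eqk; rewrite wgt_wnth_shift => e.
  have ew : wnth mu i = wnth nu i.
    apply: (@wgt_inj2 mu (shift d j nu)); by rewrite -e wgt_shift pos_wnth.
  by split=> //; rewrite ew wmu in e; apply: (addnI e).
rewrite wgt_wnth_shift wmu.
(* Both sortings list the same elements before position k, so the element that mu has at k cannot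
   come earlier in nu. *)
have le_wgt : (wgt nu (wnth mu k) <= wgt nu (wnth nu k))%N.
  rewrite wgt_leE pos_wnth leqNgt; apply/negP => lt.
  have [e _] := eqk (Ordinal (pos_lt nu (wnth mu k))) lt.
  rewrite wnth_pos in e; have /(congr1 val)/= e' := wnth_inj e.
  by rewrite e' ltnn in lt.
have [d0|d0] := posnP d; first by rewrite d0 !mul0n !addn0 ltnNge le_wgt.
have dM : (0 < d * M)%N by rewrite muln_gt0 d0 (M_gt0 j).
move=> lt; have : (d * M * (k <= j) < d * M * (wnth mu k \in I))%N.
  by rewrite -(ltn_add2l (wgt nu (wnth nu k))) (leq_trans lt) // leq_add2r.
rewrite ltn_mul2l dM /=; have [kj|jk] := leqP k j; first by case: (wnth mu k \in I).
case inI: (wnth mu k \in I) => // _.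
(* A gain at a position beyond j requires an element of I there, but the top j.+1 elements of nu
   already exhaust I. *)
have sub : top j nu \subset I.
  apply/fintype.subsetP => x; rewrite top_wnth => /imsetP[i]; rewrite inE => le ->.
  have [_] := eqk i (leq_ltn_trans le jk).
  by rewrite le => /eqP; rewrite eqn_pmul2l //; case: (_ nu i \in I).
have eI : top j nu = I by apply/eqP; rewrite eqEcard sub cI card_top leqnn.
rewrite -eI inE in inI.
have := leq_ltn_trans inI jk; rewrite -[X in (_ < X)%N](pos_wnth nu k) -wgt_ltE.
by rewrite ltnNge le_wgt.
Qed.

Lemma indicator_inj d : (0 < d)%N -> injective (indicator d).
Proof.
move=> d0 I J /mnmP e; apply/setP => x; have := e x; rewrite !mnmE => /eqP.
by rewrite eqn_pmul2l //; case: (x \in I); case: (x \in J).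
Qed.

Lemma add_indicator_eq_shift d j nu (I : {set 'I_n}) : (0 < d)%N ->
  (nu + indicator d I)%MM = shift d j nu -> I = top j nu.
Proof. by move=> d0; rewrite shift_top => /addmI/indicator_inj; apply. Qed.

(** The value 0 past the end makes the last [gap] the smallest weight itself. *)
Definition wgt_nth nu (k : nat) : nat :=
  if insub k is Some i then wgt nu (wnth nu i) else 0%N.

Lemma wgt_nth_ord nu k : wgt_nth nu k = wgt nu (wnth nu k).
Proof. by rewrite /wgt_nth valK. Qed.

Lemma wgt_nth_default nu (k : nat) : (n <= k)%N -> wgt_nth nu k = 0%N.
Proof. by move=> le; rewrite /wgt_nth insubF // ltnNge le. Qed.

Definition gap j nu : nat := (wgt nu (wnth nu j) - wgt_nth nu j.+1)%N.

(* The number of times that shift (d j) j can be undone, starting from nu. *)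
Definition shifts (d : 'I_n -> nat) j nu : nat := (gap j nu %/ (d j * M))%N.

(** Unless i = j, a shift at i raises the positions j and j.+1 together or leaves both. *)
Lemma gap_shift d i j nu : gap j (shift d i nu) = (gap j nu + d * M * (i == j))%N.
Proof.
rewrite /gap wgt_wnth_shift; have [lt|ge] := ltnP j.+1 n; last first.
  have je : j.+1 = n by apply/eqP; rewrite eqn_leq ge ltn_ord.
  rewrite !wgt_nth_default // !subn0; congr (_ + _ * nat_of_bool _)%N.
  by rewrite -val_eqE /=; move: (ltn_ord i) ge; lia.
have nE mu : wgt_nth mu j.+1 = wgt mu (wnth mu (Ordinal lt)) by rewrite -wgt_nth_ord.
rewrite !nE wgt_wnth_shift /= -val_eqE /=.
have := @wgt_lt_wnth nu j (Ordinal lt) (leqnn _).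
by case: (ltngtP j i) => //; lia.
Qed.

Lemma shifts_shift (d : 'I_n -> nat) i j nu : (0 < d j)%N ->
  shifts d j (shift (d i) i nu) = (shifts d j nu + (i == j))%N.
Proof.
move=> dj; rewrite /shifts gap_shift; case: eqP => [->|_]; last by rewrite muln0 !addn0.
by rewrite muln1 divnDr ?dvdnn // divnn muln_gt0 dj (M_gt0 j).
Qed.

Lemma gap_wgt j nu x y : (pos nu x <= j < pos nu y)%N ->
  (wgt nu y + gap j nu <= wgt nu x)%N.
Proof.
move=> /andP[xj jy]; have lt : (j.+1 < n)%N := leq_ltn_trans jy (pos_lt nu y).
have : (wgt nu y <= wgt nu (wnth nu (Ordinal lt)))%N by rewrite wgt_leE pos_wnth.
have : (wgt nu (wnth nu j) <= wgt nu x)%N by rewrite wgt_leE pos_wnth.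
have := @wgt_lt_wnth nu j (Ordinal lt) (leqnn _).
by rewrite /gap (_ : wgt_nth nu j.+1 = wgt_nth nu (Ordinal lt)) // wgt_nth_ord; lia.
Qed.

Lemma gap_le_wgt j nu x : (pos nu x <= j)%N -> (gap j nu <= wgt nu x)%N.
Proof.
move=> le; apply: (leq_trans (leq_subr _ _)).
by rewrite wgt_leE pos_wnth.
Qed.

(** When the gap in weight is at least d M, lowering the top j.+1 entries by d cannot move one of
    them below another element: the weights stay ordered, and equality is excluded because distinct
    elements have distinct labels modulo M. *)
Lemma unshift (d : nat) j nu : (0 < d)%N -> (d * M <= gap j nu)%N ->
  exists2 mu, shift d j mu = nu & pos mu = pos nu.
Proof.
move=> d0 le; pose mu : 'X_{1..n} := [multinom nu x - d * (pos nu x <= j) | x < n].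
have dle x : (d * (pos nu x <= j) <= nu x)%N.
  have [/gap_le_wgt/(leq_trans le)|_] := leqP (pos nu x) j; last by rewrite muln0.
  by rewrite muln1 -(wgt_div nu x) leq_divRL ?(M_gt0 x).
have wmu x : wgt nu x = (wgt mu x + d * M * (pos nu x <= j))%N.
  by rewrite /wgt mnmE -{1}(subnK (dle x)); lia.
have emu : wseq mu = wseq nu.
  apply: eq_wseq => x y lt; have lt' := lt; rewrite wgt_ltE in lt'.
  move: (wmu x) (wmu y); case: (leqP (pos nu x) j) => xj.
    by rewrite (leq_trans (ltnW lt') xj) => ex ey; move: lt; rewrite ex ey ltn_add2r.
  case: (leqP (pos nu y) j) => yj; last by rewrite !muln0 !addn0 => <- <-.
  rewrite muln0 addn0 muln1 => ex ey.
  have := @gap_wgt j nu y x; rewrite yj xj => /(_ isT) le2.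
  rewrite ltn_neqAle; apply/andP; split; last by rewrite -ex; move: le le2; rewrite ey; lia.
  by apply/eqP => /wgt_inj2 e; rewrite e ltnn in lt.
have pmu : pos mu = pos nu by rewrite /pos emu.
exists mu => //; apply/mnmP => x; rewrite shiftE pmu mnmE subnK //.
Qed.

(* What is left of nu once all the shifts are undone. *)
Definition residue (d : 'I_n -> nat) nu : 'X_{1..n} :=
  [multinom nu x - \sum_j d j * shifts d j nu * (pos nu x <= j) | x < n].

Lemma residue_shift (d : 'I_n -> nat) i nu : (forall j, 0 < d j)%N ->
  residue d (shift (d i) i nu) = residue d nu.
Proof.
move=> d0; apply/mnmP => x; rewrite !mnmE pos_shift.
rewrite (eq_bigr (fun j => d j * shifts d j nu * (pos nu x <= j) +
   (if j == i then d i * (pos nu x <= i) else 0)))%N; last first.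
  move=> j _; rewrite shifts_shift // eq_sym; case: eqP => [->|_]; last by rewrite !addn0.
  by rewrite mulnDr mulnDl muln1.
by rewrite big_split /= -big_mkcond big_pred1_eq subnDr.
Qed.

Lemma residue_shifts0 (d : 'I_n -> nat) nu : (forall j, shifts d j nu = 0%N) ->
  residue d nu = nu.
Proof. by move=> H; apply/mnmP => x; rewrite mnmE big1 ?subn0 // => j _; rewrite H muln0. Qed.

End SortedExponents.

(** * Dickson's lemma *)

Section WellQuasiOrder.

(** [g N] is a place where h attains its minimum over the indices from N on; iterating such choices
    gives the subsequence. *)
Lemma nondecreasing_subsequence (h : nat -> nat) :
  exists phi : nat -> nat, {homo phi : i j / (i < j)%N} /\
    {homo h \o phi : i j / (i <= j)%N}.
Proof.
have /choice[g gP] : forall N, exists i, (N <= i)%N /\ forall k, (N <= k -> h i <= h k)%N.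
  move=> N; have : exists v, `[< exists i, (N <= i)%N /\ h i = v >].
    by exists (h N); apply/asboolP; exists N.
  case/ex_minnP => v /asboolP[i [Ni <-]] vmin; exists i; split=> // k Nk.
  by apply: vmin; apply/asboolP; exists k.
pose phi k := iter k (fun i => g i.+1) (g 0%N).
have phiS k : phi k.+1 = g (phi k).+1 by [].
exists phi; split.
  by apply: homo_ltn => [? ? ?|k]; [exact: ltn_trans|rewrite phiS; case: (gP (phi k).+1)].
apply: homo_leq => [?|? ? ?|k]; [exact: leqnn|exact: leq_trans|].
rewrite /comp phiS; case: k => [|k].
  by case: (gP 0%N) => _; apply; apply: leq0n.
rewrite phiS; case: (gP (phi k).+1) => le1; apply.
have [le2 _] := gP (g (phi k).+1).+1.
exact: leq_trans le1 (ltnW le2).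
Qed.

Lemma dickson (T : finType) (f : nat -> T -> nat) :
  exists i j, (i < j)%N /\ forall t, (f i t <= f j t)%N.
Proof.
suff [phi [phi_lt H]] : exists phi : nat -> nat, {homo phi : i j / (i < j)%N} /\
    forall t, t \in enum T -> {homo (fun k => f (phi k) t) : i j / (i <= j)%N}.
  exists (phi 0%N), (phi 1%N); split; first exact: phi_lt.
  by move=> t; apply: H => //; rewrite mem_enum.
elim: (enum T) => [|t ts [phi [phi_lt IH]]]; first by exists id; split.
have [psi [psi_lt H]] := nondecreasing_subsequence (fun k => f (phi k) t).
exists (phi \o psi); split=> [i j /psi_lt/phi_lt //|u].
rewrite inE => /predU1P[->|/IH mono]; first exact: H.
move=> i j ij; apply: mono; move: ij; rewrite leq_eqVlt => /predU1P[->//|/psi_lt].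
exact: ltnW.
Qed.

(** Otherwise every finite list in P can be extended by an element of P above none of its members,
    and iterating the choice gives a sequence without a related pair. *)
Lemma finite_basis (T : choiceType) (R : T -> T -> Prop) (P : T -> Prop) :
  (forall f : nat -> T, (forall i, P (f i)) -> exists i j, (i < j)%N /\ R (f i) (f j)) ->
  exists s : seq T, (forall x, x \in s -> P x) /\
    forall y, P y -> exists2 x, x \in s & R x y.
Proof.
move=> wqo; apply: contrapT => nfin.
have next (s : seq T) : exists y, (forall x, x \in s -> P x) ->
    P y /\ forall x, x \in s -> ~ R x y.
  apply: contrapT => H; apply: nfin; exists s; split=> [x xs|y Py].
    by apply: contrapT => nPx; apply: H; exists x => /(_ _ xs).
  apply: contrapT => nR; apply: H; exists y => _; split=> // x xs Rxy.
  by apply: nR; exists x.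
have [g gP] := choice next.
pose l k := iter k (fun s => rcons s (g s)) [::].
have lP k : forall x, x \in l k -> P x.
  elim: k => //= k IH x; rewrite mem_rcons inE => /predU1P[->|/IH//].
  by case: (gP _ IH).
have lS i j : (i < j)%N -> g (l i) \in l j.
  elim: j => // j IH; rewrite ltnS leq_eqVlt /= mem_rcons inE => /predU1P[->|/IH ->].
    by rewrite eqxx.
  by rewrite orbT.
have [i|i [j [/lS ij Rij]]] := wqo (fun i => g (l i)); first by case: (gP _ (lP i)).
by case: (gP _ (lP j)) => _ /(_ _ ij).
Qed.

End WellQuasiOrder.

(** * Finitely generated ideals and fractions *)

Section InIdeal.
Variable R : comNzRingType.

Lemma in_ideal_is_ideal (s : seq R) : is_ideal (in_ideal s).
Proof.
split; first by exists (fun=> 0); rewrite big1 // => i _; rewrite mul0r.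
move=> a _ _ [c ->] [d ->]; exists (fun i => a * c i + d i).
by rewrite mulr_sumr -big_split; apply: eq_bigr => i _; rewrite mulrDl mulrA.
Qed.

Lemma in_ideal_mem (s : seq R) x : x \in s -> in_ideal s x.
Proof.
move=> xs; exists (fun i => (i == index x s)%:R).
rewrite -index_mem in xs; rewrite (bigD1 (Ordinal xs)) //= eqxx mul1r big1.
  by rewrite addr0 nth_index // -index_mem.
by move=> i; rewrite -val_eqE /= => /negPf ->; rewrite mul0r.
Qed.

Lemma in_ideal_sub (s : seq R) (J : set R) : is_ideal J ->
  (forall x, x \in s -> J x) -> forall x, in_ideal s x -> J x.
Proof.
move=> HJ sJ _ [c ->]; apply: big_ind => [|x y|i _]; first by case: HJ.
  exact: is_idealD.
by apply: is_idealM => //; apply/sJ/mem_nth.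
Qed.

End InIdeal.

Lemma fracP (A : idomainType) (x : {fraction A}) :
  exists a b, b != 0 /\ x = FracField.tofrac a / FracField.tofrac b.
Proof.
elim/quotW: x => y; exists (\n_y), (\d_y); split; first exact: denom_ratioP.
have d0 : FracField.tofrac \d_y != 0 by rewrite tofrac_eq0 denom_ratioP.
apply: (canRL (mulfK d0)).
have : FracField.mul (\pi_{fraction A} y)%qT (FracField.tofrac \d_y) = FracField.tofrac \n_y.
  apply/eqP; rewrite piE FracField.equivfE /FracField.mulf.
  rewrite !numden_Ratio ?oner_neq0 ?mulr1 ?denom_ratioP //.
  by rewrite mulrC.
by [].
Qed.

(** * Monoid algebras *)

Section MonoidAlgebra.
Variables (K : fieldType) (n : nat) (S : set 'X_{1..n}).
Hypothesis S0 : S 0%MM.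
Hypothesis SD : forall m1 m2, S m1 -> S m2 -> S (m1 + m2)%MM.

Local Notation A := (subalg_gen (@monomials K n S)).

Definition supported (f : {mpoly K[n]}) : Prop := forall m, f@_m != 0 -> S m.

Lemma supportedX m : S m -> supported 'X_[m].
Proof.
move=> Sm k; rewrite mcoeffX; case: (m =P k) => [<- //|_].
by rewrite eqxx.
Qed.

Lemma supportedD f g : supported f -> supported g -> supported (f + g).
Proof.
move=> Sf Sg m; rewrite mcoeffD; have [f0|f0 _] := eqVneq f@_m 0; last exact: Sf.
by rewrite f0 add0r; apply: Sg.
Qed.

Lemma supportedZ c f : supported f -> supported (c *: f).
Proof. by move=> Sf m; rewrite mcoeffZ mulf_eq0 negb_or => /andP[_]; apply: Sf. Qed.

Lemma supportedM f g : supported f -> supported g -> supported (f * g).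
Proof.
move=> Sf Sg m; rewrite -mcoeff_msupp => /msuppM_le /allpairsP[[u v] /= [uf vg ->]].
by apply: SD; [apply: Sf|apply: Sg]; rewrite -mcoeff_msupp.
Qed.

Lemma mem_subalg f : (f \in subalg_pred (@monomials K n S)) <-> supported f.
Proof.
split=> [/subalg_predP H|Sf].
  suff /asPredP : f \in asPred supported by [].
  apply: H => [|_ [m Sm ->]]; last by apply/asPredP/supportedX.
  split=> [|a u v /asPredP Su /asPredP Sv|u v /asPredP Su /asPredP Sv]; apply/asPredP.
  - by rewrite -mpolyX0; apply: supportedX.
  - by apply: supportedD => //; apply: supportedZ.
  - exact: supportedM.
rewrite (mpolyE f) rpred_sum // => m _.
have [->|m0] := eqVneq f@_m 0; first by rewrite scale0r rpred0.
by rewrite rpredZ //; apply: mem_subalg_pred; exists m => //; apply: Sf.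
Qed.

Definition mon m (Sm : S m) : A :=
  SubalgGen (mem_subalg_pred (ex_intro2 _ _ m Sm erefl)).

Lemma subalg_supported (a : A) : supported (val a).
Proof. by apply/mem_subalg; case: a. Qed.

Definition of_supported f (Sf : supported f) : A := SubalgGen ((mem_subalg f).2 Sf).

Lemma val_subalg_eq0 (a : A) : (val a == 0) = (a == 0).
Proof. by rewrite -(rmorph0 (val : A -> _)) (inj_eq val_inj). Qed.

Lemma mlead_subalg (a : A) : a != 0 -> S (mlead (val a)).
Proof.
move=> a0; apply: (@subalg_supported a).
by rewrite mleadc_eq0 val_subalg_eq0.
Qed.

Lemma monoid_algebra_basis :
  is_basis [set f : A | @monomials K n S (val f)].
Proof.
split.
  move=> s c us sB /(congr1 val); rewrite rmorph0 rmorph_sum /= => e v vs.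
  have [m Sm vm] := sB v vs.
  move/(congr1 (mcoeff m)): e; rewrite mcoeff0 raddf_sum (bigD1_seq v) //=.
  rewrite mcoeffZ vm mcoeffX eqxx mulr1 big1_seq ?addr0 // => w /andP[wv ws].
  have [k Sk wk] := sB w ws; rewrite mcoeffZ wk mcoeffX.
  case: eqP => [km|]; last by rewrite mulr0.
  by case/eqP: wv; apply: val_inj; rewrite wk vm km.
move=> w; have Sw := @subalg_supported w.
pose u m : A := if pselect (S m) is left Sm then mon Sm else 0.
have uE m : m \in msupp (val w) -> val (u m) = 'X_[m].
  rewrite mcoeff_msupp => /Sw Sm; rewrite /u; by case: pselect.
(* Coefficients must be a function of the basis vector, so its exponent is recovered as its leading
   exponent. *)
exists (map u (msupp (val w))), (fun v => (val w)@_(mlead (val v))); split.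
  move=> _ /mapP[m mw ->]; exists m; last exact: uE.
  by apply: Sw; rewrite -mcoeff_msupp.
apply: val_inj; rewrite big_map rmorph_sum /= [LHS]mpolyE.
apply: eq_big_seq => m mw.
transitivity ((val w)@_(mlead (val (u m))) *: val (u m)); last by [].
by rewrite (uE m mw) mleadXm.
Qed.

(* Division of leading terms, with respect to the monomial order of mlead. *)
Lemma cancel_lead (a b : A) m : a != 0 -> b != 0 -> S m ->
  mlead (val a) = (m + mlead (val b))%MM ->
  exists c, (a - c * b = 0) \/ (mlead (val (a - c * b)) < mlead (val a))%O.
Proof.
move=> a0 b0 Sm e.
have b0' : val b != 0 by rewrite val_subalg_eq0.
have X0 : 'X_[m] != 0 :> {mpoly K[n]}.
  by rewrite -msupp_eq0 msuppX.
have lb : (val b)@_(mlead (val b)) != 0 by rewrite mleadc_eq0.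
set c := (val a)@_(mlead (val a)) / (val b)@_(mlead (val b)).
exists (c *: mon Sm); set d := a - _.
have [d0|d0] := eqVneq d 0; [by left|right].
have vd : val d = val a - c *: ('X_[m] * val b).
  by rewrite /d rmorphB rmorphM /= -scalerAl.
have vd0 : val d != 0 by rewrite val_subalg_eq0.
have lXb : mlead ('X_[m] * val b) = mlead (val a) by rewrite mleadM // mleadXm.
have da : (val d)@_(mlead (val a)) = 0.
  have eX : ('X_[m] * val b)@_(mlead (val a)) = (val b)@_(mlead (val b)).
    by rewrite e mulrC mcoeffMX.
  by rewrite vd mcoeffB mcoeffZ eX /c mulfVK // subrr.
rewrite lt_neqAle; apply/andP; split.
  by apply/eqP => ed; move: vd0; rewrite -mleadc_eq0 ed da eqxx.
rewrite vd; apply: (le_trans (mleadB_le _ _)); rewrite leUx lexx /=.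
by rewrite -lXb mleadZ_le.
Qed.

(** With x = a / b integral of degree N, d = b^N clears the denominators of the powers below N; the
    integral equation expresses every higher power through lower ones without new denominators. *)
Lemma integral_almost_integral (B : idomainType) (x : {fraction B}) :
  integralOver (@FracField.tofrac B) x -> exists2 d : B, d != 0 &
    forall k, exists h, FracField.tofrac d * x ^+ k = FracField.tofrac h.
Proof.
have [a [b [b0 ->]]] := fracP x => -[p pm /eqP pr].
set y := _ / _ in pr *.
have fb0 : FracField.tofrac b != 0 by rewrite tofrac_eq0.
have [N sp] : exists N, size p = N.+1.
  by exists (size p).-1; rewrite prednK // size_poly_gt0 monic_neq0.
have pN : p`_N = 1 by move/monicP: pm; rewrite /lead_coef sp.
have yN : y ^+ N = - \sum_(i < N) FracField.tofrac p`_i * y ^+ i.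
  move: pr; rewrite (@horner_coef_wide _ N.+1) ?(leq_trans (size_poly _ _)) ?sp //.
  rewrite big_ord_recr /= coef_map /= pN tofrac1 mul1r => /eqP.
  rewrite addrC addr_eq0 => /eqP ->; congr (- _).
  by apply: eq_bigr => i _; rewrite coef_map.
exists (b ^+ N); first exact: expf_neq0.
elim/ltn_ind => k IH; have [kN|Nk] := ltnP k N.
  exists (a ^+ k * b ^+ (N - k)); rewrite tofracM !tofracXn expr_div_n.
  rewrite -{1}(subnK (ltnW kN)) exprD -mulrA mulrC; congr (_ * _).
  by rewrite mulrC divfK ?expf_neq0.
have /choice[h hP] : forall i : 'I_N, exists h,
    FracField.tofrac (b ^+ N) * y ^+ (k - N + i) = FracField.tofrac h.
  by move=> i; apply: IH; rewrite -{2}(subnK Nk) ltn_add2l.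
exists (- \sum_(i < N) p`_i * h i).
rewrite -(subnK Nk) exprD yN mulrN mulrN tofracN rmorph_sum /=; congr (- _).
rewrite !mulr_sumr; apply: eq_bigr => i _; rewrite tofracM -hP exprD; ring.
Qed.

Lemma integral_subr (B : comNzRingType) (F : fieldType) (f : {rmorphism B -> F}) x c :
  integralOver f x -> integralOver f (x - f c).
Proof. by move=> xi; apply: integral_sub xi (integral_id _ _). Qed.

Lemma tofrac_divB (B : idomainType) (a c b : B) : b != 0 ->
  FracField.tofrac (a - c * b) / FracField.tofrac b =
    FracField.tofrac a / FracField.tofrac b - FracField.tofrac c.
Proof. by move=> b0; rewrite tofracB tofracM mulrBl mulfK // tofrac_eq0. Qed.

Lemma integral_tofrac_divB (B : idomainType) (a c b : B) : b != 0 ->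
  integralOver (@FracField.tofrac B) (FracField.tofrac a / FracField.tofrac b) ->
  integralOver (@FracField.tofrac B) (FracField.tofrac (a - c * b) / FracField.tofrac b).
Proof.
by move=> b0 ai; rewrite (tofrac_divB a c b0); exact: (@integral_subr B {fraction B} _ _ c ai).
Qed.

Lemma monoid_algebra_normal :
  (forall d l m, S d -> S l -> S m ->
     (forall k, exists2 h, S h & (d + l *+ k = h + m *+ k)%MM) ->
     exists2 p, S p & l = (p + m)%MM) ->
  normal_domain A.
Proof.
move=> Hnorm x; have [a [b [b0 ->]]] := fracP x => {x}.
have fb0 : FracField.tofrac b != 0 by rewrite tofrac_eq0.
have vb0 : val b != 0 by rewrite val_subalg_eq0.
(* The denominator b stays fixed; only the numerator is reduced, by multiples of b, which keeps the
   fraction integral. *)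
elim/(well_founded_ind (@ltom_wf n)): (mlead (val a)) {-2}a (erefl (mlead (val a)))
  => l IH {}a el aint.
have [->|a0] := eqVneq a 0; first by exists 0; rewrite tofrac0 mul0r.
have va0 : val a != 0 by rewrite val_subalg_eq0.
have [d d0 dP] := integral_almost_integral aint.
have vd0 : val d != 0 by rewrite val_subalg_eq0.
have [|p Sp ep] := Hnorm _ _ _ (mlead_subalg d0) (mlead_subalg a0) (mlead_subalg b0).
  move=> k; have [h] := dP k; rewrite expr_div_n mulrA => /(canRL (divfK (expf_neq0 k fb0))).
  rewrite -!tofracXn -!tofracM => /eqP; rewrite tofrac_eq => /eqP e.
  have h0 : h != 0.
    by apply: contra_eqN e => /eqP ->; rewrite mul0r mulf_neq0 ?expf_neq0.
  have vh0 : val h != 0 by rewrite val_subalg_eq0.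
  exists (mlead (val h)); first exact: mlead_subalg.
  move/(congr1 (fun z : A => mlead (val z))): e; rewrite !rmorphM !rmorphXn /=.
  by rewrite !mleadM ?expf_neq0 // !mleadX.
have [c cP] := cancel_lead a0 b0 Sp ep.
have fc := tofrac_divB a c b0.
case: cP => [e|lt].
  exists c; apply/eqP; rewrite -subr_eq0 -fc e tofrac0 mul0r; exact: eqxx.
have ic := integral_tofrac_divB c b0 aint.
rewrite el in lt; have [c' e] := IH _ lt (a - c * b) erefl ic.
by exists (c' + c); rewrite tofracD -e fc subrK.
Qed.

Definition divides_in (m1 m2 : 'X_{1..n}) : Prop := exists2 m, S m & m2 = (m1 + m)%MM.

Definition wqo_in : Prop := forall f : nat -> 'X_{1..n}, (forall i, S (f i)) ->
  exists i j, (i < j)%N /\ divides_in (f i) (f j).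

(** As in the proof of Hilbert's basis theorem by leading terms: finitely many elements of I have
    leading exponents that divide, within S, all those of I, and division by them ends because the
    monomial order is well founded. *)
Lemma monoid_algebra_noetherian : wqo_in -> noetherian A.
Proof.
move=> wqo I HI; have II := is_ideal_closed HI.
pose P m := exists2 a : A, (a \in I) && (a != 0) & mlead (val a) = m.
have [|s [sP sB]] := @finite_basis _ divides_in P.
  move=> f Pf; apply: wqo => i; have [a /andP[_ a0] <-] := Pf i.
  exact: mlead_subalg.
have /choice[g gP] : forall m, exists a : A, P m -> [/\ a \in I, a != 0 & mlead (val a) = m].
  move=> m; have [[a /andP[aI a0] e]|nP] := pselect (P m); first by exists a.
  by exists 0.
exists (map g s) => x; split; last first.
  apply: (in_ideal_sub II) => _ /mapP[m /sP/gP[gI _ _] ->]; exact: gI.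
have JJ := in_ideal_is_ideal (map g s).
elim/(well_founded_ind (@ltom_wf n)): (mlead (val x)) {-2}x (erefl (mlead (val x)))
  => l IH {}x el xI.
have [->|x0] := eqVneq x 0; first by case: JJ.
have [|m ms [p Sp ep]] := sB (mlead (val x)); first by exists x; rewrite ?xI.
have [gI g0 ge] := gP _ (sP _ ms).
have [|c cP] := cancel_lead x0 g0 Sp; first by rewrite ge addmC.
have gs : in_ideal (map g s) (g m) by apply/in_ideal_mem/map_f.
rewrite -[x](subrK (c * g m)); apply: (is_idealD JJ); last exact: is_idealM.
case: cP => [->|lt]; first by case: JJ.
apply: IH erefl _; first by rewrite -el.
by apply: (is_idealB II) => //; apply: (is_idealM _ II).
Qed.

(** The zero exponent is left out of the basis so that splitting off a generator lowers the
    degree. *)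
Lemma wqo_fg_submonoid : wqo_in -> fg_submonoid S.
Proof.
move=> wqo; pose P m := S m /\ m != 0%MM.
have [|s [sP sB]] := @finite_basis _ divides_in P.
  by move=> f Pf; apply: wqo => i; case: (Pf i).
exists s => m; split=> [|[c ->]]; last first.
  apply: (big_ind S) => // i _; have [Si _] := sP _ (mem_nth 0%MM (ltn_ord i)).
  elim: (c i) => [|k IH]; first by rewrite mulm0n.
  by rewrite mulmS; apply: SD.
elim/ltn_ind: (mdeg m) {-2}m (erefl (mdeg m)) => d IH {}m ed Sm.
have [->|m0] := eqVneq m 0%MM.
  by exists (fun=> 0%N); rewrite big1 // => i _; rewrite mulm0n.
have [|g gs [p Sp ep]] := sB m; first by split.
have [_ g0] := sP _ gs.
have [||c ec] := IH (mdeg p) _ p erefl => //.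
  by rewrite -ed ep mdegD -[X in (X < _)%N]add0n ltn_add2r lt0n mdeg_eq0.
exists (fun i => (c i + (i == index g s))%N).
have -> : (\sum_(i < size s) nth 0 s i *+ (c i + (i == index g s :> nat)) =
    (\sum_(i < size s) nth 0 s i *+ c i) +
    \sum_(i < size s) nth 0 s i *+ (i == index g s :> nat))%MM.
  rewrite -big_split; apply: eq_bigr => i _.
  by apply/mnmP => x; rewrite mnmDE !mulmnE mulnDr.
rewrite -ec ep addmC; congr (_ + _)%MM.
have gi : (index g s < size s)%N by rewrite index_mem.
rewrite (bigD1 (Ordinal gi)) //= eqxx mulm1n nth_index // big1 ?addm0 // => i.
by rewrite -val_eqE /= => /negPf ->; rewrite mulm0n.
Qed.

Lemma monoid_algebra_affine : wqo_in -> affine_semigroup_ring A.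
Proof.
move=> wqo; exists n, S; split; first exact: wqo_fg_submonoid.
by exists idfun; exists id.
Qed.

End MonoidAlgebra.

(** * Leading terms for the sorted order *)

Section OrderReversingExponents.
Variables (n : nat) (leP : rel 'I_n) (Q : pred 'I_n).

Definition reversing_exponent : set 'X_{1..n} :=
  [set nu | (forall x y, leP x y -> (nu y <= nu x)%N) /\
            forall y, Q y -> (2 %| nu y)%N]%classic.

Lemma reversing_exponent0 : reversing_exponent 0%MM.
Proof. by split=> [x y _|y _]; rewrite !mnmE. Qed.

Lemma reversing_exponentD m1 m2 : reversing_exponent m1 -> reversing_exponent m2 ->
  reversing_exponent (m1 + m2)%MM.
Proof.
move=> [H1 Q1] [H2 Q2]; split=> [x y xy|y yQ]; rewrite !mnmDE.
  by rewrite leq_add ?H1 ?H2.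
by rewrite dvdn_add ?Q1 ?Q2.
Qed.

Definition down_set (I : {set 'I_n}) : bool :=
  [forall x, forall y, leP x y ==> (y \in I) ==> (x \in I)].

Lemma down_setP (I : {set 'I_n}) : reflect (forall x y, leP x y -> y \in I -> x \in I) (down_set I).
Proof.
apply: (iffP forallP) => [H x y xy yI|H x].
  by have /forallP/(_ y) := H x; rewrite xy yI.
by apply/forallP => y; apply/implyP => xy; apply/implyP; apply: H.
Qed.

Lemma indicator_reversing d (I : {set 'I_n}) : (2 %| d)%N -> down_set I ->
  reversing_exponent (indicator d I).
Proof.
move=> d2 /down_setP dI; split=> [x y xy|y _]; rewrite !mnmE; last exact: dvdn_mulr.
rewrite leq_mul2l; case yI: (y \in I); last by rewrite orbT.
by rewrite (dI x y xy yI) orbT.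
Qed.

Variables (M : nat) (r : 'I_n -> nat).
Hypothesis r_inj : injective r.
Hypothesis r_lt : forall x, (r x < M)%N.
Hypothesis r_anti : forall x y, leP x y -> x != y -> (r y < r x)%N.

(** Since labels decrease along the order, being order-reversing only depends on the sorting: it
    means that the sorting is a linear extension. Operations that keep the sorting therefore keep
    this property. *)
Lemma reversing_wgt nu : reversing_exponent nu ->
  forall x y, leP x y -> x != y -> (wgt M r nu y < wgt M r nu x)%N.
Proof.
move=> [H _] x y xy xny; apply: (leq_ltn_trans (n := (nu x * M + r y)%N)).
  by rewrite leq_add2r leq_mul2r H ?orbT.
by rewrite ltn_add2l r_anti.
Qed.

Lemma wgt_reversing nu :
  (forall x y, leP x y -> x != y -> (wgt M r nu y < wgt M r nu x)%N) ->
  forall x y, leP x y -> (nu y <= nu x)%N.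
Proof.
move=> H x y xy; have [->//|xny] := eqVneq x y.
by rewrite -(wgt_div r_lt nu x) -(wgt_div r_lt nu y) leq_div2r // ltnW // H.
Qed.

Lemma shift_reversing d j nu : (2 %| d)%N -> reversing_exponent nu ->
  reversing_exponent (shift M r d j nu).
Proof.
move=> d2 Snu; split=> [|y yQ].
  by apply: wgt_reversing => x y xy xny; apply: wgt_shift_lt => //; apply: reversing_wgt.
by rewrite shiftE dvdn_add ?dvdn_mulr //; case: Snu => _; apply.
Qed.

Lemma unshift_reversing d j nu : (0 < d)%N -> (2 %| d)%N -> reversing_exponent nu ->
  (d * M <= gap M r j nu)%N ->
  exists2 mu, reversing_exponent mu & shift M r d j mu = nu.
Proof.
move=> d0 d2 Snu le; have [mu emu pmu] := unshift r_inj r_lt d0 le.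
exists mu => //; split=> [|y yQ].
  apply: wgt_reversing => x y xy xny; rewrite wgt_ltE // pmu -wgt_ltE //.
  exact: reversing_wgt.
case: Snu => _ /(_ y yQ); rewrite -emu shiftE dvdn_addl //.
exact: dvdn_mulr.
Qed.

Lemma top_down_set j nu : reversing_exponent nu -> down_set (top M r j nu).
Proof.
move=> Snu; apply/down_setP => x y xy; rewrite !inE => yj.
have [->//|xny] := eqVneq x y.
by apply: leq_trans yj; rewrite ltnW // -wgt_ltE // reversing_wgt.
Qed.

End OrderReversingExponents.

Section LeadingTerms.
Variables (K : fieldType) (n M : nat) (r : 'I_n -> nat).
Hypothesis r_inj : injective r.
Hypothesis r_lt : forall x, (r x < M)%N.

Local Notation wv := (wvec M r).
Implicit Types (f g : {mpoly K[n]}) (nu mu : 'X_{1..n}).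

Definition leading f nu : Prop :=
  f@_nu != 0 /\ forall mu, f@_mu != 0 -> (wv mu <= wv nu)%O.

Lemma leading_uniq f nu mu : leading f nu -> leading f mu -> nu = mu.
Proof.
move=> [a b] [c d]; apply: (wvec_inj r_inj r_lt).
by apply: le_anti; rewrite d // b.
Qed.

Lemma leading_exists f : f != 0 -> exists nu, leading f nu.
Proof.
move=> f0.
suff H (s : seq 'X_{1..n}) : s != [::] ->
    exists2 nu, nu \in s & forall mu, mu \in s -> (wv mu <= wv nu)%O.
  have [|nu nuf numax] := H (msupp f); first by rewrite msupp_eq0.
  exists nu; split; first by rewrite -mcoeff_msupp.
  by move=> mu; rewrite -mcoeff_msupp; apply: numax.
elim: s => // x s IH _; have [->|s0] := eqVneq s [::].
  by exists x; rewrite ?mem_head // => mu; rewrite inE => /eqP ->.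
have [y ys ymax] := IH s0; case: (leP (wv x) (wv y)) => [le|/ltW le].
  exists y; first by rewrite inE ys orbT.
  by move=> mu; rewrite inE => /predU1P[->//|/ymax].
exists x; first exact: mem_head.
by move=> mu; rewrite inE => /predU1P[->//|/ymax/le_trans]; apply.
Qed.

Lemma leadingX nu : leading 'X_[nu] nu.
Proof.
split=> [|mu]; first by rewrite mcoeffX eqxx oner_neq0.
by rewrite mcoeffX; case: (nu =P mu) => [->|_]; rewrite ?lexx ?eqxx.
Qed.

Lemma leadingD f g nu : leading f nu ->
  (forall mu, g@_mu != 0 -> (wv mu < wv nu)%O) -> leading (g + f) nu.
Proof.
move=> [f0 fmax] gmax; split.
  rewrite mcoeffD; have [->|/gmax] := eqVneq g@_nu 0; first by rewrite add0r.
  by rewrite ltxx.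
move=> mu; rewrite mcoeffD; have [->|/gmax/ltW //] := eqVneq g@_mu 0.
by rewrite add0r; apply: fmax.
Qed.

Lemma mcoeffXM_neq0 k g mu : ('X_[k] * g)@_mu != 0 ->
  exists2 u, mu = (k + u)%MM & g@_u != 0.
Proof.
rewrite -mcoeff_msupp => /msuppM_le /allpairsP[[u v] /= [uk vg ->]].
exists v; last by rewrite -mcoeff_msupp.
by move: uk; rewrite msuppX inE => /eqP ->.
Qed.

Lemma mcoeff_sum_neq0 (I : Type) (s : seq I) (P : pred I) (F : I -> {mpoly K[n]}) mu :
  (\sum_(i <- s | P i) F i)@_mu != 0 -> exists2 i, P i & (F i)@_mu != 0.
Proof.
move=> H; apply: contrapT => nex; case/eqP: H.
rewrite raddf_sum big1 // => i Pi; apply/eqP/negPn/negP => F0.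
by apply: nex; exists i.
Qed.

Variables (leP : rel 'I_n) (Q : pred 'I_n).
Hypothesis r_anti : forall x y, leP x y -> x != y -> (r y < r x)%N.
Local Notation S := (reversing_exponent leP Q).

(* Indices start at 0: theta j sums over the order ideals with j.+1 elements. *)
Definition theta (j : 'I_n) : {mpoly K[n]} :=
  \sum_(I : {set 'I_n} | (#|I| == j.+1) && down_set leP I) 'X_[indicator 2 I].

Lemma theta_supported j : supported S (theta j).
Proof.
move=> m /mcoeff_sum_neq0[I /andP[_ dI]]; rewrite mcoeffX.
case: (indicator 2 I =P m) => [<- _|_]; last by rewrite eqxx.
exact: indicator_reversing.
Qed.

(** For mu in the support of g and I of size j.+1, mu + 2 I is at most the shift of mu, hence at
    most that of nu. Equality forces mu = nu and I = [top M r j nu], so the leading coefficient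
    arises from one product and cannot cancel. *)
Lemma theta_leading j g nu : supported S g -> leading g nu ->
  leading (theta j * g) (shift M r 2 j nu).
Proof.
move=> Sg [g0 gmax].
have le mu (I : {set 'I_n}) : #|I| == j.+1 -> g@_mu != 0 ->
    (wv (indicator 2 I + mu)%MM <= wv (shift M r 2 j mu))%O.
  by move=> /eqP cI _; rewrite addmC; apply: wvec_add_indicator.
have le2 mu : g@_mu != 0 -> (wv (shift M r 2 j mu) <= wv (shift M r 2 j nu))%O.
  move/gmax; rewrite le_eqVlt => /orP[/eqP/(wvec_inj r_inj r_lt) ->|lt]; first exact: lexx.
  by apply: ltW; apply: wvec_shift_lt.
rewrite mulr_suml; split; last first.
  move=> mu /mcoeff_sum_neq0[I /andP[cI _]] /mcoeffXM_neq0[u -> gu].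
  exact: le_trans (le _ _ cI gu) (le2 _ gu).
have top_ok : (#|top M r j nu| == j.+1) && down_set leP (top M r j nu).
  by rewrite card_top ?eqxx //= (top_down_set r_inj r_lt r_anti _ (Sg _ g0)).
rewrite raddf_sum (bigD1 (top M r j nu)) //= [X in _ + X]big1 ?addr0.
  by rewrite shift_top mulrC addmC mcoeffMX.
move=> I /andP[/andP[cI _] Itop]; apply/eqP/negPn/negP => /mcoeffXM_neq0[u e gu].
have eu : u = nu.
  have := le _ _ cI gu; rewrite -e => le3.
  have := le2 _ gu; rewrite le_eqVlt => /orP[/eqP/(wvec_inj r_inj r_lt)/(shift_inj r_inj r_lt) //|lt].
  by have := le_lt_trans le3 lt; rewrite ltxx.
case/eqP: Itop; apply: (add_indicator_eq_shift (d := 2) (nu := nu)) => //.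
by rewrite e eu addmC.
Qed.

(** The top power of theta j dominates, since shifting by more gives a strictly larger exponent. *)
Lemma theta_horner_leading (p : {poly K}) (d : nat) j g nu :
  p \is monic -> size p = d.+1 -> supported S g -> leading g nu ->
  leading ((map_poly (@mpolyC n K) p).[theta j] * g) (shift M r (2 * d) j nu).
Proof.
move=> pm sp Sg lg.
have H i : supported S (theta j ^+ i * g) /\
    leading (theta j ^+ i * g) (shift M r (2 * i) j nu).
  elim: i => [|i [IHS IHl]]; first by rewrite mul1r muln0 shift0.
  rewrite exprS -mulrA; split.
    by apply: supportedM => //; [exact: reversing_exponentD|exact: theta_supported].
  by rewrite mulnS -shiftD //; apply: theta_leading.
rewrite (@horner_coef_wide _ d.+1) ?(leq_trans (size_poly _ _)) ?sp //.
rewrite big_ord_recr /= mulrDl coef_map /= (_ : p`_d = 1); last first.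
  by move/monicP: pm; rewrite /lead_coef sp.
rewrite mpolyC1 mul1r; apply: leadingD; first by case: (H d).
move=> mu; rewrite mulr_suml => /mcoeff_sum_neq0[i _].
rewrite coef_map /= -mulrA mul_mpolyC mcoeffZ mulf_eq0 negb_or => /andP[_ hm].
apply: (le_lt_trans ((H i).2.2 _ hm)); apply: wvec_lt_shift => //.
by rewrite ltn_pmul2l // ltn_ord.
Qed.

End LeadingTerms.

(** * A regular sequence *)

Section ShiftBasis.
Variables (K : fieldType) (n M : nat) (r : 'I_n -> nat).
Hypothesis r_inj : injective r.
Hypothesis r_lt : forall x, (r x < M)%N.
Variables (leP : rel 'I_n) (Q : pred 'I_n).
Hypothesis r_anti : forall x y, leP x y -> x != y -> (r y < r x)%N.
Variables (d : 'I_n -> nat) (F : 'I_n -> {mpoly K[n]}).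
Local Notation S := (reversing_exponent leP Q).
Local Notation wv := (wvec M r).
Local Notation A := (subalg_gen (@monomials K n S)).
Hypothesis d_gt0 : forall j, (0 < d j)%N.
Hypothesis d_even : forall j, (2 %| d j)%N.
Hypothesis F_supp : forall j, supported S (F j).
Hypothesis F_leading : forall j g nu, supported S g -> leading M r g nu ->
  leading M r (F j * g) (shift M r (d j) j nu).
Implicit Types (f g : {mpoly K[n]}) (nu mu : 'X_{1..n}) (Z : set 'X_{1..n}).

Let S0 : S 0%MM := reversing_exponent0 leP Q.
Let SD := @reversing_exponentD n leP Q.

Local Notation sh j := (shift M r (d j) j).
Local Notation k j := (shifts M r d j).

(** Multiplication by F j mirrors one shift at j, and nu is its residue shifted [k j nu] times at
    each j. So the monomials of the residues are the candidates for a basis over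
    K[F_1, ..., F_n]. *)
Definition shift_basis nu : {mpoly K[n]} :=
  (\prod_j F j ^+ k j nu) * 'X_[residue M r d nu].

Lemma shift_basis_shift j nu : shift_basis (sh j nu) = F j * shift_basis nu.
Proof.
rewrite /shift_basis residue_shift // mulrA; congr (_ * _).
under eq_bigr => i _ do rewrite shifts_shift // exprD.
rewrite big_split mulrC; congr (_ * _).
rewrite (bigD1 j) //= eqxx expr1 big1 ?mulr1 // => i ij.
by rewrite eq_sym (negPf ij).
Qed.

Lemma unshift_exists j nu : S nu -> (0 < k j nu)%N -> exists2 mu, S mu & sh j mu = nu.
Proof.
move=> Snu kj; apply: (unshift_reversing r_inj r_lt r_anti) => //.
have M0 : (0 < M)%N := leq_ltn_trans (leq0n _) (r_lt j).
by move: kj; rewrite divn_gt0 // muln_gt0 d_gt0.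
Qed.

Lemma shift_basisP nu : S nu -> supported S (shift_basis nu) /\ leading M r (shift_basis nu) nu.
Proof.
elim/ltn_ind: (\sum_j k j nu)%N {-2}nu (erefl (\sum_j k j nu)%N) => s IH {}nu es Snu.
have [[j kj]|nk] := pselect (exists j, (0 < k j nu)%N).
  have [mu Smu emu] := unshift_exists Snu kj.
  have [||Sb lb] := IH (\sum_i k i mu)%N _ mu erefl => //.
    rewrite -es -emu [X in (_ < X)%N](eq_bigr (fun i => k i mu + (j == i))%N) => [|i _]; last first.
      by rewrite (shifts_shift r_inj r_lt j mu (d_gt0 i)).
    by rewrite big_split /= -[X in (X < _)%N]addn0 ltn_add2l (bigD1 j) //= eqxx.
  rewrite -emu shift_basis_shift; split; first exact: supportedM.
  exact: F_leading.
have k0 j : k j nu = 0%N.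
  by apply/eqP; rewrite -leqn0 leqNgt; apply/negP => kj; apply: nk; exists j.
rewrite /shift_basis residue_shifts0 // big1 ?mul1r => [|j _]; last by rewrite k0.
by split; [exact: supportedX|exact: leadingX].
Qed.

Definition expand g : {mpoly K[n]} := \sum_(m <- msupp g) g@_m *: shift_basis m.

Lemma expand_wide g s : uniq s -> {subset msupp g <= s} ->
  expand g = \sum_(m <- s) g@_m *: shift_basis m.
Proof.
move=> us sub; rewrite [RHS](bigID (fun m => m \in msupp g)) /= [X in _ + X]big1 ?addr0.
  rewrite -big_filter; apply: perm_big; apply: uniq_perm; rewrite ?filter_uniq ?msupp_uniq //.
  by move=> m; rewrite mem_filter; case mg: (m \in _) => //=; rewrite (sub _ mg).
by move=> m; rewrite -mcoeff_eq0 => /eqP ->; rewrite scale0r.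
Qed.

(** Z selects part of the basis: the ideals generated by initial parameters, and complements to
    them, become coordinate subspaces. *)
Definition spanned Z f : Prop :=
  exists2 g, (forall m, g@_m != 0 -> S m /\ Z m) & f = expand g.

Lemma spannedD Z f f' : spanned Z f -> spanned Z f' -> spanned Z (f + f').
Proof.
move=> [g gZ ->] [h hZ ->]; exists (g + h).
  move=> m; rewrite mcoeffD; have [->|/gZ //] := eqVneq g@_m 0.
  by rewrite add0r; apply: hZ.
pose s := undup (msupp g ++ msupp h ++ msupp (g + h)).
rewrite !(@expand_wide _ s) ?undup_uniq //.
- by rewrite -big_split; apply: eq_bigr => m _; rewrite mcoeffD scalerDl.
- by move=> m mg; rewrite mem_undup !mem_cat mg !orbT.
- by move=> m mg; rewrite mem_undup !mem_cat mg !orbT.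
- by move=> m mg; rewrite mem_undup !mem_cat mg.
Qed.

Lemma spannedZ Z c f : spanned Z f -> spanned Z (c *: f).
Proof.
move=> [g gZ ->]; exists (c *: g).
  by move=> m; rewrite mcoeffZ mulf_eq0 negb_or => /andP[_ /gZ].
rewrite (@expand_wide (c *: g) (msupp g)) ?msupp_uniq //; last exact: msuppZ_le.
by rewrite scaler_sumr; apply: eq_bigr => m _; rewrite mcoeffZ scalerA.
Qed.

Lemma spanned0 Z : spanned Z 0.
Proof.
by exists 0; [move=> m; rewrite mcoeff0 eqxx|rewrite /expand msupp0 big_nil].
Qed.

Lemma spanned_sum (I : eqType) Z (s : seq I) (P : pred I) (f : I -> {mpoly K[n]}) :
  (forall i, i \in s -> P i -> spanned Z (f i)) -> spanned Z (\sum_(i <- s | P i) f i).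
Proof.
move=> H; rewrite big_seq_cond; apply: big_ind => [||i /andP[]].
- exact: spanned0.
- by move=> ? ?; apply: spannedD.
- exact: H.
Qed.

Lemma spanned_basis Z m : S m -> Z m -> spanned Z (shift_basis m).
Proof.
move=> Sm Zm; exists 'X_[m] => [k|]; last first.
  by rewrite /expand msuppX big_seq1 mcoeffX eqxx scale1r.
by rewrite mcoeffX; case: (m =P k) => [<-|_]; rewrite ?eqxx.
Qed.

(** The basis elements have distinct leading exponents, so the largest one in a combination
    survives. Linear independence follows in the form of [spanned_disjoint]. *)
Lemma spanned_leading Z f : spanned Z f -> f != 0 ->
  exists2 nu, Z nu & leading M r f nu.
Proof.
move=> [g gZ ->] f0.
have g0 : g != 0.
  by apply: contraNneq f0 => ->; rewrite /expand msupp0 big_nil.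
have [nu [gnu numax]] := leading_exists M r g0.
exists nu; first by case: (gZ _ gnu).
have le m mu : g@_m != 0 -> (shift_basis m)@_mu != 0 -> (wv mu <= wv m)%O.
  by move=> /gZ[/shift_basisP[_ [_ H]] _]; apply: H.
have [_ [bnu _]] := shift_basisP (gZ _ gnu).1.
have nus : nu \in msupp g by rewrite mcoeff_msupp.
split.
  rewrite raddf_sum (bigD1_seq nu) ?msupp_uniq //= [X in _ + X]big1 ?addr0.
    by rewrite mcoeffZ mulf_neq0.
  move=> m mnu; rewrite mcoeffZ; apply/eqP/negPn/negP; rewrite mulf_eq0 negb_or.
  move=> /andP[gm bm]; case/eqP: mnu; apply: (wvec_inj r_inj r_lt).
  by apply: le_anti; rewrite numax ?le.
move=> mu /mcoeff_sum_neq0[m _]; rewrite mcoeffZ mulf_eq0 negb_or => /andP[gm bm].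
exact: le_trans (le _ _ gm bm) (numax _ gm).
Qed.

Lemma spanned_disjoint Z Z' f : (forall nu, Z nu -> ~ Z' nu) ->
  spanned Z f -> spanned Z' f -> f = 0.
Proof.
move=> ZZ' fZ fZ'; apply/eqP/negPn/negP => f0.
have [nu Znu lnu] := spanned_leading fZ f0.
have [mu Zmu lmu] := spanned_leading fZ' f0.
by apply: (ZZ' nu) => //; rewrite (leading_uniq r_inj r_lt lnu lmu).
Qed.

(** Triangularity: up to a nonzero scalar, the basis element of nu is its monomial plus smaller
    ones, and the lexicographic order on tuples of fixed length is well founded. *)
Lemma spanned_monomial nu : S nu -> spanned setT 'X_[nu].
Proof.
move: {-2}nu (erefl (wv nu)).
suff H (t : n.-tuplelexi nat) : forall nu, wv nu = t -> S nu -> spanned setT 'X_[nu].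
  by move=> mu _; apply: (H (wv mu)).
elim/(@ltxwf _ nat): t => [P IH x|t IH mu emu Smu].
  by elim/ltn_ind: x => x; apply: IH.
have [Sb [b0 bmax]] := shift_basisP Smu; set c := (shift_basis mu)@_mu in b0.
have -> : 'X_[mu] = c^-1 *: (shift_basis mu -
    \sum_(m <- msupp (shift_basis mu) | m != mu) (shift_basis mu)@_m *: 'X_[m]).
  rewrite {1}[shift_basis mu]mpolyE (bigD1_seq mu) ?msupp_uniq ?mcoeff_msupp //=.
  by rewrite addrK scalerA mulVf // scale1r.
apply: spannedZ; apply: spannedD; first exact: spanned_basis.
rewrite -scaleN1r; apply: spannedZ; apply: spanned_sum => m.
rewrite mcoeff_msupp => mb mmu; apply: spannedZ; apply: IH erefl (Sb _ mb).
rewrite -emu lt_neqAle bmax // andbT.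
by apply: contraNneq mmu => /(wvec_inj r_inj r_lt) ->.
Qed.

Lemma spanned_supported f : supported S f -> spanned setT f.
Proof.
move=> Sf; rewrite (mpolyE f); apply: spanned_sum => m; rewrite mcoeff_msupp => mf _.
by apply/spannedZ/spanned_monomial/Sf.
Qed.

Lemma spanned_split Z f : supported S f ->
  exists f1 f2, [/\ f = f1 + f2, spanned Z f1 & spanned (~` Z)%classic f2].
Proof.
move=> /spanned_supported[g gS ->].
exists (\sum_(m <- msupp g | `[< Z m >]) g@_m *: shift_basis m).
exists (\sum_(m <- msupp g | ~~ `[< Z m >]) g@_m *: shift_basis m).
split; first by rewrite /expand (bigID (fun m => `[< Z m >])).

  apply: spanned_sum => m; rewrite mcoeff_msupp => /gS[Sm _] /asboolP Zm.
  by apply/spannedZ/spanned_basis.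
apply: spanned_sum => m; rewrite mcoeff_msupp => /gS[Sm _] /asboolP Zm.
by apply/spannedZ/spanned_basis.
Qed.

Lemma spanned_mul Z Z' j f : (forall m, Z m -> Z' (sh j m)) ->
  spanned Z f -> spanned Z' (F j * f).
Proof.
move=> ZZ' [g gZ ->]; rewrite mulr_sumr; apply: spanned_sum => m.
rewrite mcoeff_msupp => /gZ[Sm Zm] _; rewrite -scalerAr -shift_basis_shift.
by apply/spannedZ/spanned_basis; [apply: shift_reversing|apply: ZZ'].
Qed.

Definition shifted_below (i : nat) nu : Prop :=
  exists2 j : 'I_n, (j < i)%N & (0 < k j nu)%N.

Definition params : seq A :=
  [seq of_supported S0 SD (@F_supp j) | j <- enum 'I_n].

Lemma size_params : size params = n.
Proof. by rewrite size_map size_enum_ord. Qed.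

Lemma nth_params (j : 'I_n) : val params`_j = F j.
Proof.
by rewrite (nth_map j) ?size_enum_ord // nth_ord_enum.
Qed.

(** Multiplying by F j shifts basis elements, and a basis element whose exponent can be unshifted at
    j is a multiple of F j. *)
Lemma in_ideal_params i (x : A) : (i <= n)%N ->
  in_ideal (take i params) x <-> spanned (shifted_below i) (val x).
Proof.
move=> le; have sz : size (take i params) = i.
  by rewrite size_takel // size_params.
split=> [[c ->]|[g gZ e]].
  rewrite rmorph_sum /=; apply: spanned_sum => -[j /= jlt] _ _.
  rewrite sz in jlt; rewrite nth_take // mulrC.
  rewrite -[X in spanned _ X]/(val params`_j * val (c j)).
  have jn : (j < n)%N := leq_trans jlt le.
  have -> : val params`_j = F (Ordinal jn) := nth_params (Ordinal jn).
  apply: (@spanned_mul setT); last first.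
    by apply: spanned_supported; apply: (@subalg_supported K n S S0 SD (c j)).
  by move=> m _; exists (Ordinal jn) => //; rewrite shifts_shift // eqxx addn1.
have [II0 IID] := in_ideal_is_ideal (take i params).
suff [y ey hy] : exists2 y : A, val y = expand g & in_ideal (take i params) y.
  by rewrite (_ : x = y) //; apply: val_inj; rewrite ey e.
rewrite /expand big_seq; apply: (big_ind (fun f => exists2 y : A, val y = f & in_ideal (take i params) y)).
- by exists 0 => //; rewrite rmorph0.
- move=> _ _ [y <- hy] [z <- hz]; exists (y + z); first by rewrite rmorphD.
  exact: (is_idealD (in_ideal_is_ideal _)).
move=> m; rewrite mcoeff_msupp => /gZ[Sm [j ji /(unshift_exists Sm)[mu Smu <-]]].
rewrite shift_basis_shift; have [Sb _] := shift_basisP Smu.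
exists (g@_(sh j mu) *: (of_supported S0 SD Sb * params`_j)).
  transitivity (g@_(sh j mu) *: (shift_basis mu * val params`_j)); first by [].
  by rewrite nth_params mulrC.
rewrite -mulr_algl.
do 2?apply: (is_idealM _ (in_ideal_is_ideal _)); apply: in_ideal_mem.
by rewrite -(nth_take 0 ji) mem_nth ?sz.
Qed.

(** A shift at i leaves the counts at smaller indices alone, so F_i preserves both the ideal of the
    earlier parameters and its coordinate complement. The component f2 of b in the complement thus
    has F_i f2 in both, whence F_i f2 = 0 and f2 = 0. *)
Lemma regular_params i (b : A) : (i < size params)%N ->
  in_ideal (take i params) (params`_i * b) -> in_ideal (take i params) b.
Proof.
rewrite size_params => lt; pose j := Ordinal lt.
rewrite !in_ideal_params ?(ltnW lt) // rmorphM /= -[i in params`_i]/(val j) nth_params => H.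
have keep Z : Z = shifted_below i \/ Z = (~` shifted_below i)%classic ->
    forall m, Z m -> Z (sh j m).
  have kE (l : 'I_n) m : (l < i)%N -> k l (sh j m) = k l m.
    move=> li; rewrite shifts_shift // (_ : j == l = false) ?addn0 //.
    by apply/eqP => /(congr1 val) /= e; rewrite e ltnn in li.
  move=> [->|->] m /=; first by move=> [l li kl]; exists l; rewrite ?kE.
  by move=> nZ [l li kl]; apply: nZ; exists l; rewrite -?(kE l m).
have [f1 [f2 [e f1Z f2Z]]] :=
  spanned_split (shifted_below i) (@subalg_supported _ _ _ S0 SD b).
have F2 : F j * f2 = 0.
  apply: (@spanned_disjoint (shifted_below i) (~` shifted_below i)%classic).
  - by move=> nu Z /(_ Z).
  - rewrite (_ : F j * f2 = F j * val b + (-1) *: (F j * f1)).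
      apply: spannedD H _; apply: spannedZ; apply: spanned_mul f1Z.
      by apply: keep; left.
    by rewrite e scaleN1r mulrDr addrAC subrr add0r.
  - by apply: spanned_mul f2Z; apply: keep; right.
have F0 : F j != 0.
  have [||H0 _] := @F_leading j 1 0%MM.
  - by rewrite -mpolyX0; apply: supportedX.
  - suff : leading M r ('X_[0%MM] : {mpoly K[n]}) 0%MM by rewrite mpolyX0.
    exact: leadingX.
  by apply: contraNneq H0 => ->; rewrite mul0r mcoeff0.
move/eqP: F2; rewrite mulf_eq0 (negPf F0) /= => /eqP f20.
by rewrite e f20 addr0.
Qed.

End ShiftBasis.

(** * Cohen-Macaulayness *)

Section MaximalIdeals.
Variables (A : comNzRingType) (m : {pred A}).
Hypothesis m_max : is_maximal_ideal m.

Lemma maximal_inverse b : b \notin m -> exists c, c * b - 1 \in m.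
Proof.
move=> bm; have [mI mmax] := m_max; have II := is_ideal_closed mI.
have IJ := is_ideal_adjoin b II; set J := (X in is_ideal X) in IJ.
have [[a [u [um e]]]|J1] := pselect (J 1).
  exists a; rewrite e (_ : _ - _ = -1 * u); last by ring.
  exact: (is_idealM (-1) II um).
have JE : asPred J =i m.
  apply: mmax => [|z zm]; last by apply/asPredP; exists 0, z; rewrite mul0r addr0.
  split; first by apply/asPredP; case: IJ.
    by apply/asPredP.
  by move=> a u v /asPredP Ju /asPredP Jv; apply/asPredP; case: IJ => _; apply.
case/negP: bm; rewrite -JE; apply/asPredP.
by exists 1, 0; rewrite add0r mul1r; split=> //; case: II.
Qed.

End MaximalIdeals.

Section ResidueField.
Variables (A : comNzRingType) (m : prime_idealr A).
Hypothesis m_max : is_maximal_ideal (m : {pred A}).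

(** The proof of maximality is an argument of the type so that the field instance, whose axioms need
    it, can be attached to the type. *)
Definition residue_field of is_maximal_ideal (m : {pred A}) : Type := {ideal_quot m}.
Local Notation L := (residue_field m_max).

HB.instance Definition _ := GRing.ComNzRing.on L.

Definition residue_map (a : A) : L := (\pi_{ideal_quot m} a)%qT.

Lemma residue_map_zmod : zmod_morphism residue_map.
Proof. by move=> a b; rewrite /residue_map rmorphB. Qed.

Lemma residue_map_monoid : monoid_morphism residue_map.
Proof. by split=> [|a b]; rewrite /residue_map ?rmorph1 ?rmorphM. Qed.

HB.instance Definition _ := GRing.isZmodMorphism.Build A L residue_map residue_map_zmod.
HB.instance Definition _ := GRing.isMonoidMorphism.Build A L residue_map residue_map_monoid.

Lemma residue_map_eq0 a : (residue_map a == 0) = (a \in (m : {pred A})).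
Proof.
by rewrite -(rmorph0 residue_map) /residue_map -Quotient.idealrBE subr0.
Qed.

Lemma residue_map_surj (y : L) : exists a, y = residue_map a.
Proof. by exists (repr (y : {ideal_quot m})); rewrite /residue_map reprK. Qed.

Definition residue_inv (y : L) : L :=
  if pselect (exists z, z * y = 1) is left H then projT1 (cid H) else 0.

Lemma residue_mulVf y : y != 0 -> residue_inv y * y = 1.
Proof.
have [b ->] := residue_map_surj y; rewrite residue_map_eq0 => bm.
rewrite /residue_inv; case: pselect => [H|[]]; first by case: cid.
have [c] := maximal_inverse m_max bm.
rewrite -residue_map_eq0 rmorphB rmorphM rmorph1 subr_eq0 => /eqP e.
by exists (residue_map c).
Qed.

Lemma residue_inv0 : residue_inv 0 = 0.
Proof.
rewrite /residue_inv; case: pselect => // H; exfalso.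
by case: H => z /esym/eqP; rewrite mulr0 oner_eq0.
Qed.

HB.instance Definition _ := GRing.ComNzRing_isField.Build L residue_mulVf residue_inv0.

End ResidueField.

Section CohenMacaulay.
Variables (K : fieldType) (n M : nat) (r : 'I_n -> nat).
Hypothesis r_inj : injective r.
Hypothesis r_lt : forall x, (r x < M)%N.
Variables (leP : rel 'I_n) (Q : pred 'I_n).
Hypothesis r_anti : forall x y, leP x y -> x != y -> (r y < r x)%N.
Local Notation S := (reversing_exponent leP Q).
Local Notation A := (subalg_gen (@monomials K n S)).

Let S0 : S 0%MM := reversing_exponent0 leP Q.
Let SD := @reversing_exponentD n leP Q.

(* Since S is cut out by the forms nu x and nu x - nu y, it is enough to apply
   Dickson's lemma to their values. *)
Lemma reversing_wqo : wqo_in S.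
Proof.
move=> f Sf.
pose h i (t : 'I_n + 'I_n * 'I_n) : nat :=
  match t with inl x => f i x | inr p => (f i p.1 - f i p.2)%N end.
have [i [j [ij hP]]] := dickson h; exists i, j; split=> //.
have le x : (f i x <= f j x)%N := hP (inl x).
exists (f j - f i)%MM; last first.
  by apply/mnmP => x; rewrite mnmDE mnmBE subnKC.
have [[Hi Qi] [Hj Qj]] := (Sf i, Sf j); split=> [x y xy|y yQ]; rewrite !mnmBE.
  have /= := hP (inr (x, y)); have := Hi _ _ xy; have := Hj _ _ xy.
  by have := le x; have := le y; lia.
by rewrite dvdn_sub ?Qi ?Qj.
Qed.

(** A linear form that is nonnegative on S cannot be negative on l - m, or large k would make it
    negative on d + k (l - m). The forms nu x and nu x - nu y are at most d x on d, so k = d x + 1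
    is large enough. *)
Lemma reversing_saturated d l m : S d -> S l -> S m ->
  (forall k, exists2 h, S h & (d + l *+ k = h + m *+ k)%MM) ->
  exists2 p, S p & l = (p + m)%MM.
Proof.
move=> Sd [Hl Ql] [Hm Qm] H.
have E k : exists2 h, S h & forall x, (d x + l x * k = h x + m x * k)%N.
  have [h Sh e] := H k; exists h => // x.
  by have := congr1 (fun v : 'X_{1..n} => v x) e; rewrite !mnmDE !mulmnE.
have le x : (m x <= l x)%N.
  have [h _ /(_ x)] := E (d x).+1; have [//|lt] := leqP (m x) (l x).
  by have : ((l x).+1 * (d x).+1 <= m x * (d x).+1)%N; [rewrite leq_mul2r lt orbT|lia].
exists (l - m)%MM; last by apply/mnmP => x; rewrite mnmDE mnmBE subnK.
split=> [x y xy|y yQ]; rewrite !mnmBE; last by rewrite dvdn_sub ?Ql ?Qm.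
have [h [Hh _] e] := E (d x).+1; have := Hh _ _ xy.
have := e x; have := e y; have := le x; have := le y.
have [//|lt] := leqP (l y - m y) (l x - m x).
have : (((l x - m x).+1) * (d x).+1 <= (l y - m y) * (d x).+1)%N by rewrite leq_mul2r lt orbT.
by rewrite mulSn !mulnBl; lia.
Qed.

Lemma generated_residue (m : prime_idealr A) (mx : is_maximal_ideal (m : {pred A})) :
  exists xs, generated_over (residue_map mx \o in_alg A) xs.
Proof.
have [s sP] := wqo_fg_submonoid S0 SD reversing_wqo.
pose u k : A := if pselect (S k) is left Sk then mon K Sk else 0.
exists [seq residue_map mx (u k) | k <- s] => T [T1 TB TM] Tphi Txs y.
have [a ->] := residue_map_surj y.
have TD x z : x \in T -> z \in T -> x + z \in T.
  by move=> xT zT; rewrite -[z]opprK -[- z]sub0r; apply/TB/TB => //; rewrite -(subrr 1); apply: TB.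
(* The pull-back of T to polynomials is a subalgebra, so only monomials have to be checked, and
   among these only the generators of S. *)
pose T' f := exists2 b : A, val b = f & residue_map mx b \in T.
suff [b /val_inj -> //] : T' (val a).
have /subalg_predP H := subalg_valP a.
suff /asPredP : val a \in asPred T' by [].
apply: H.
  split=> [|c _ _ /asPredP[b <- bT] /asPredP[d <- dT]|_ _ /asPredP[b <- bT] /asPredP[d <- dT]];
    apply/asPredP.
  - by exists 1; rewrite ?rmorph1.
  - exists (c *: b + d) => //; rewrite rmorphD -mulr_algl rmorphM; apply: TD => //.
    by apply: TM => //; apply: (Tphi c).
  - by exists (b * d); rewrite // rmorphM; apply: TM.
move=> _ [k /sP[c ->] ->]; apply/asPredP.
apply: (big_ind (fun k => T' 'X_[k])) => [|k1 k2 [b e bT] [d e' dT]|i _].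
- by exists 1; rewrite ?rmorph1 ?mpolyX0.
- by exists (b * d); rewrite ?rmorphM ?TM //= e e' mpolyXD.
have iS : nth 0%MM s i \in s by apply: mem_nth.
have Si : S (nth 0%MM s i).
  apply/sP; exists (fun j => (j == i :> nat) : nat); rewrite (bigD1 i) //= eqxx mulm1n.
  by rewrite big1 ?addm0 // => j; rewrite -val_eqE /= => /negPf ->; rewrite mulm0n.
elim: (c i) => [|j [b e bT]].
  by exists 1; rewrite ?rmorph1 ?mulm0n ?mpolyX0.
exists (u (nth 0%MM s i) * b).
  rewrite mulmS mpolyXD -e rmorphM /= /u; by case: pselect.
by rewrite rmorphM; apply: TM => //; apply/Txs/map_f.
Qed.

(** The residue field is algebraic over K by Zariski's lemma. The polynomial is not constant, as a
    monic constant is 1, which is outside m. *)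
Lemma maximal_ideal_params (m : prime_idealr A) : is_maximal_ideal (m : {pred A}) ->
  forall x : A, exists p : {poly K}, [/\ p \is monic, (1 < size p)%N &
    (map_poly (in_alg A) p).[x] \in (m : {pred A})].
Proof.
move=> mx x; have [xs gen] := generated_residue mx.
have [p pm] := zariski gen (residue_map mx x).
rewrite map_poly_comp /= => /rootP; rewrite horner_map /= => /eqP.
rewrite residue_map_eq0 => pxm; exists p; split=> //.
rewrite ltnNge; apply/negP => /size1_polyC e; move: pm pxm.
rewrite e monicE lead_coefC => /eqP ->; rewrite rmorph1 hornerC idealr1 //.
Qed.

Lemma reversing_cohen_macaulay : cohen_macaulay A.
Proof.
split; first exact: (monoid_algebra_noetherian S0 SD reversing_wqo).
move=> m mx.
pose th j : A := of_supported S0 SD (@theta_supported K n leP Q j).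
have /choice[p pP] : forall j, exists p : {poly K}, [/\ p \is monic, (1 < size p)%N &
    (map_poly (in_alg A) p).[th j] \in (m : {pred A})].
  by move=> j; apply: maximal_ideal_params.
pose Fa j : A := (map_poly (in_alg A) (p j)).[th j].
pose F j := (map_poly (@mpolyC n K) (p j)).[theta K leP j].
have FE j : val (Fa j) = F j.
  pose v : {rmorphism A -> {mpoly K[n]}} := val.
  transitivity (map_poly v (map_poly (in_alg A) (p j))).[v (th j)].
    by rewrite horner_map.
  rewrite -map_poly_comp; congr (_.[_]); apply: eq_map_poly => c.
  transitivity (c *: (1 : {mpoly K[n]})); first by [].
  exact: alg_mpolyC.
(* Twice the degree of p j: each factor theta j of the top power shifts by 2. *)
pose d j := (2 * (size (p j)).-1)%N.
have d0 j : (0 < d j)%N.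
  by have [_ sp _] := pP j; rewrite muln_gt0 /= -ltnS prednK // ltnW.
have d2 j : (2 %| d j)%N by apply: dvdn_mulr.
have FS j : supported S (F j) by rewrite -FE; apply: subalg_supported.
have Fl j g nu : supported S g -> leading M r g nu ->
    leading M r (F j * g) (shift M r (d j) j nu).
  move=> Sg lg; have [pm sp _] := pP j.
  have sp' : size (p j) = (size (p j)).-1.+1 by rewrite prednK // ltnW.
  exact: (theta_horner_leading r_inj r_lt r_anti j pm sp' Sg lg).
have Fm : {subset params FS <= (m : {pred A})}.
  move=> _ /mapP[j _ ->]; have [_ _ Fjm] := pP j.
  rewrite (_ : of_supported _ _ _ = Fa j) //.
  by apply: val_inj; rewrite FE.
apply: (@localization_cohen_macaulay _ m (params FS)) => //.
- split.
    move=> /(in_ideal_sub (is_ideal_closed mx.1) Fm) /=.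
    by rewrite idealr1.
  move=> i lt b; exact: (@regular_params K n M r r_inj r_lt leP Q r_anti d F d0 d2 FS Fl i b lt).
- rewrite size_params.
  apply: (@prime_chain_leq K n A (in_alg A) (val : {rmorphism A -> {mpoly K[n]}})).
    exact: val_inj.
  by move=> c; exact: alg_mpolyC.
Qed.

End CohenMacaulay.

(** * The doset Hibi ring *)

Section LinearExtensionLabels.
Variables (n : nat) (leP : rel 'I_n).
Hypothesis leP_refl : reflexive leP.
Hypothesis leP_anti : antisymmetric leP.
Hypothesis leP_trans : transitive leP.

(* The summand x only makes the labels distinct. *)
Definition reverse_label (x : 'I_n) : nat := ((n - #|[pred z | leP z x]|) * n + x)%N.

Lemma reverse_label_inj : injective reverse_label.
Proof.
move=> x y /(congr1 (modn^~ n)); rewrite !modnMDl !modn_small ?ltn_ord //.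
exact: val_inj.
Qed.

Lemma reverse_label_lt x : (reverse_label x < n * n + n)%N.
Proof. by rewrite /reverse_label -addnS leq_add ?ltn_ord // leq_mul2r leq_subr orbT. Qed.

Lemma reverse_label_anti x y : leP x y -> x != y -> (reverse_label y < reverse_label x)%N.
Proof.
move=> xy xny; have lt : (#|[pred z | leP z x]| < #|[pred z | leP z y]|)%N.
  apply: proper_card; apply/properP; split.
    by apply/fintype.subsetP => z; rewrite !inE => /leP_trans; apply.
  exists y; rewrite !inE ?leP_refl //; apply: contra xny => yx.
  by apply/eqP/leP_anti; rewrite xy yx.
have le := max_card [pred z | leP z y]; rewrite card_ord in le.
rewrite /reverse_label; apply: (@leq_trans ((n - #|[pred z | leP z y]|).+1 * n)).
  by have := ltn_ord y; rewrite mulSn; lia.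
apply: (@leq_trans ((n - #|[pred z | leP z x]|) * n)); last exact: leq_addr.
rewrite leq_mul2r; apply/orP; right; apply: ltn_sub2l => //.
exact: leq_trans lt le.
Qed.

End LinearExtensionLabels.

Section DosetExponents.
Variables (disp : Order.disp_t) (H : finTBDistrLatticeType disp) (Q : {set joinIrr H}).

Definition ord_le : rel 'I_#|{: joinIrr H}| :=
  fun i j => (val (enum_val i) <= val (enum_val j))%O.

Definition ord_in : pred 'I_#|{: joinIrr H}| := fun i => enum_val i \in Q.

Lemma ord_le_refl : reflexive ord_le. Proof. by move=> i; apply: lexx. Qed.

Lemma ord_le_trans : transitive ord_le. Proof. by move=> j i k; apply: le_trans. Qed.

Lemma ord_le_anti : antisymmetric ord_le.
Proof. by move=> i j /le_anti/val_inj/enum_val_inj. Qed.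

Lemma TmonE (K : fieldType) (nu : {ffun joinIrr H -> nat}) :
  Tmon K nu = 'X_[[multinom nu (enum_val i) | i < #|{: joinIrr H}|]].
Proof.
rewrite mpolyXE_id /Tmon (reindex (fun i : 'I_#|{: joinIrr H}| => enum_val i)) /=; last first.
  exact/onW_bij/enum_val_bij.
by apply: eq_bigr => i _; rewrite enum_valK mnmE.
Qed.

Lemma doset_exponentP (nu : {ffun joinIrr H -> nat}) : doset_exponent Q nu <->
  reversing_exponent ord_le ord_in [multinom nu (enum_val i) | i < #|{: joinIrr H}|].
Proof.
rewrite /doset_exponent; split=> [/andP[/forallP Hle /forall_inP Hev]|[Hle Hev]].
  split=> [i j ij|i iQ]; rewrite !mnmE.
    by have /forallP/(_ (enum_val j))/implyP := Hle (enum_val i); apply.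
  by rewrite /dvdn; have := Hev _ iQ; rewrite mod0n.
apply/andP; split.
  apply/forallP => x; apply/forallP => y; apply/implyP => xy.
  have := Hle (enum_rank x) (enum_rank y); rewrite !mnmE !enum_rankK; apply.
  by rewrite /ord_le !enum_rankK.
apply/forall_inP => y yQ; have := Hev (enum_rank y); rewrite mnmE enum_rankK mod0n.
by apply; rewrite /ord_in enum_rankK.
Qed.

Lemma doset_monomialsE (K : fieldType) :
  @doset_monomials _ H K Q = @monomials K _ (reversing_exponent ord_le ord_in).
Proof.
apply/seteqP; split=> f [].
  by move=> nu /doset_exponentP Snu ->; rewrite TmonE; exists [multinom nu (enum_val i) | i < _].
move=> m Sm ->; pose nu : {ffun joinIrr H -> nat} := [ffun x => m (enum_rank x)].
have em : m = [multinom nu (enum_val i) | i < #|{: joinIrr H}|].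
  by apply/mnmP => i; rewrite mnmE ffunE enum_valK.
by exists nu; [apply/doset_exponentP; rewrite -em|rewrite TmonE -em].
Qed.

End DosetExponents.

Theorem theorem4p12 (K : fieldType) (disp : Order.disp_t)
    (H : finTBDistrLatticeType disp) (Q : {set joinIrr H}) :
  [/\ is_basis [set f : doset_hibi K Q | doset_monomials Q (val f)],
      affine_semigroup_ring (doset_hibi K Q),
      normal_domain (doset_hibi K Q) &
      cohen_macaulay (doset_hibi K Q)].
Proof.
rewrite /doset_hibi doset_monomialsE.
have S0 := reversing_exponent0 (@ord_le _ H) (ord_in Q).
have SD := @reversing_exponentD _ (@ord_le _ H) (ord_in Q).
split.
- exact: monoid_algebra_basis.
- exact: (monoid_algebra_affine K S0 SD (@reversing_wqo _ _ _)).
- exact: (monoid_algebra_normal S0 SD (@reversing_saturated _ _ _)).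
- apply: (reversing_cohen_macaulay K (@reverse_label_inj _ (@ord_le _ H))
    (@reverse_label_lt _ _)) => x y.
  apply: reverse_label_anti; [exact: ord_le_refl|exact: ord_le_anti|exact: ord_le_trans].
Qed.
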